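(* Let $\mathcal W_{2,2}=\{(a_1,a_2,a_3,a_4)\in\ell^\infty_4: a_1+a_2=a_3+a_4\}$, regarded as an operator subsystem of the C*-algebra $\ell^\infty_4=\mathbb C^4$. Then $\mathcal W_{2,2}$ is C*-nuclear, i.e. for every unital C*-algebra $\mathcal A$ the identity map $\mathcal W_{2,2}\otimes_{\min}\mathcal A\to\mathcal W_{2,2}\otimes_{\max}\mathcal A$ is a complete order isomorphism.
   Context: An operator system is a unital $*$-closed subspace of some $B(H)$; ucp means unital completely positive. An operator system $\mathcal S$ is C*-nuclear if its minimal and maximal operator system tensor products with every (unital) C*-algebra coincide (completely order isomorphically via the identity). Operator system tensor products on the algebraic tensor product $\mathcal S\otimes\mathcal T$: - $\mathcal S\otimes_{\min}\mathcal T$ has positive cones $C_r^{\min}=\{[x_{ij}]\in M_r(\mathcal S\otimes\mathcal T): [(\phi\otimes\psi)(x_{ij})]\ge 0$ for all ucp $\phi:\mathcal S\to M_p$, $\psi:\mathcal T\to M_q$, all $p,q\}$. - $\mathcal S\otimes_{\max}\mathcal T$: let $D_r^{\max}=\{X^*(S\otimes T)X: S\in M_p(\mathcal S)^+,\ T\in M_q(\mathcal T)^+,\ X \text{ a } pq\times r \text{ scalar matrix},\ p,q\in\mathbb N\}$; the positive cones are $C_r^{\max}=\{Y\in M_r(\mathcal S\otimes\mathcal T): Y+\epsilon(1\otimes 1)_r\in D_r^{\max}\ \forall\epsilon>0\}$, where $(1\otimes1)_r=I_r\otimes(1\otimes 1)$. In both cases the order unit is $1_{\mathcal S}\otimes 1_{\mathcal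 T}$. A complete order isomorphism is a linear bijection that, together with its inverse, is completely positive. *)

(* Defs.v *)
From HB Require Import structures.
From mathcomp Require Import all_boot all_order all_algebra.
From mathcomp Require Import boolp classical_sets reals complex mxtens.

Set Implicit Arguments.
Unset Strict Implicit.
Unset Printing Implicit Defensive.

Import Order.TTheory GRing.Theory Num.Theory.
Import Normc.

Local Open Scope ring_scope.
Local Open Scope complex_scope.
Local Open Scope quotient_scope.

(* The algebraic tensor product is built as the quotient of the formal sums
   of pairs (v, w) by the kernel of the universal bilinear map: two formal sums
   are identified when every bilinear map takes the same value on both.  Scalars
   are absorbed in the left factor, so lists of pairs suffice. *)

Section Tensor.
Variables (K : fieldType) (V W : lmodType K).

Definition fsum := seq (V * W).

Definition fsum_val (U : lmodType K) (b : V -> W -> U) (s : fsum) : U :=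
  \sum_(p <- s) b p.1 p.2.

Definition fsum_eq (s t : fsum) : bool :=
  `[< forall (U : lmodType K) (b : {bilinear V -> W -> U}),
        fsum_val b s = fsum_val b t >].

Lemma fsum_eq_refl : reflexive fsum_eq.
Proof. by move=> s; apply/asboolP. Qed.

Lemma fsum_eq_sym : symmetric fsum_eq.
Proof.
by move=> s t; apply/asboolP/asboolP => h U b; rewrite h.
Qed.

Lemma fsum_eq_trans : transitive fsum_eq.
Proof.
move=> t s u /asboolP h1 /asboolP h2; apply/asboolP => U b.
by rewrite h1 h2.
Qed.

Canonical fsum_equiv :=
  EquivRel fsum_eq fsum_eq_refl fsum_eq_sym fsum_eq_trans.

Definition tensor := {eq_quot fsum_eq}.
HB.instance Definition _ := Choice.on tensor.
HB.instance Definition _ := EqQuotient.on tensor.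

Definition fsum_scale (a : K) (s : fsum) : fsum :=
  [seq (a *: p.1, p.2) | p <- s].

Lemma fsum_val_cat (U : lmodType K) (b : {bilinear V -> W -> U}) s t :
  fsum_val b (s ++ t) = fsum_val b s + fsum_val b t.
Proof. by rewrite /fsum_val big_cat. Qed.

Lemma fsum_val_scale (U : lmodType K) (b : {bilinear V -> W -> U}) a s :
  fsum_val b (fsum_scale a s) = a *: fsum_val b s.
Proof.
by rewrite /fsum_val big_map scaler_sumr; apply: eq_bigr => p _; rewrite linearZl_LR.
Qed.

Lemma tensorP (s t : fsum) :
  (forall (U : lmodType K) (b : {bilinear V -> W -> U}),
     fsum_val b s = fsum_val b t) <->
  \pi_tensor s = \pi_tensor t.
Proof.
split=> [h | /eqP]; first by apply/eqP; rewrite piE; apply/asboolP.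
by rewrite piE => /asboolP.
Qed.

Lemma fsum_repr (U : lmodType K) (b : {bilinear V -> W -> U}) s :
  fsum_val b (repr (\pi_tensor s)) = fsum_val b s.
Proof. by move: U b; apply/tensorP; rewrite reprK. Qed.

Definition tensor_zero : tensor := \pi_tensor [::].
Definition tensor_add (x y : tensor) : tensor := \pi_tensor (repr x ++ repr y).
Definition tensor_scale (a : K) (x : tensor) : tensor :=
  \pi_tensor (fsum_scale a (repr x)).
Definition tensor_opp (x : tensor) : tensor := tensor_scale (-1) x.

Lemma tensor_eq (x y : tensor) :
  (forall (U : lmodType K) (b : {bilinear V -> W -> U}),
     fsum_val b (repr x) = fsum_val b (repr y)) -> x = y.
Proof. by move/tensorP; rewrite !reprK. Qed.

Lemma tensor_addA : associative tensor_add.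
Proof.
by move=> x y z; apply: tensor_eq => U b; rewrite !(fsum_repr, fsum_val_cat) addrA.
Qed.

Lemma tensor_addC : commutative tensor_add.
Proof.
by move=> x y; apply: tensor_eq => U b; rewrite !(fsum_repr, fsum_val_cat) addrC.
Qed.

Lemma tensor_add0 : left_id tensor_zero tensor_add.
Proof.
move=> x; apply: tensor_eq => U b; rewrite !(fsum_repr, fsum_val_cat).
by rewrite {1}/fsum_val big_nil add0r.
Qed.

Lemma tensor_addN : left_inverse tensor_zero tensor_opp tensor_add.
Proof.
move=> x; apply: tensor_eq => U b.
rewrite !(fsum_repr, fsum_val_cat, fsum_val_scale) scaleN1r addNr.
by rewrite /fsum_val big_nil.
Qed.

HB.instance Definition _ := GRing.isZmodule.Build tensor
  tensor_addA tensor_addC tensor_add0 tensor_addN.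

Lemma fsum_reprD (U : lmodType K) (b : {bilinear V -> W -> U}) (x y : tensor) :
  fsum_val b (repr (x + y)) = fsum_val b (repr x) + fsum_val b (repr y).
Proof. by rewrite fsum_repr fsum_val_cat. Qed.

Lemma tensor_scaleA a b (x : tensor) :
  tensor_scale a (tensor_scale b x) = tensor_scale (a * b) x.
Proof.
by apply: tensor_eq => U f; rewrite !(fsum_repr, fsum_val_scale) scalerA.
Qed.

Lemma tensor_scale1 : left_id 1 tensor_scale.
Proof.
by move=> x; apply: tensor_eq => U f; rewrite !(fsum_repr, fsum_val_scale) scale1r.
Qed.

Lemma tensor_scaleDr : right_distributive tensor_scale +%R.
Proof.
move=> a x y; apply: tensor_eq => U f.
by rewrite !(fsum_reprD, fsum_repr, fsum_val_scale) scalerDr.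
Qed.

Lemma tensor_scaleDl (x : tensor) :
  {morph tensor_scale^~ x : a b / a + b}.
Proof.
move=> a b; apply: tensor_eq => U f.
by rewrite !(fsum_reprD, fsum_repr, fsum_val_scale) scalerDl.
Qed.

HB.instance Definition _ := GRing.Zmodule_isLmodule.Build K tensor
  tensor_scaleA tensor_scale1 tensor_scaleDr tensor_scaleDl.

Lemma fsum_reprZ (U : lmodType K) (b : {bilinear V -> W -> U}) a (x : tensor) :
  fsum_val b (repr (a *: x)) = a *: fsum_val b (repr x).
Proof. by rewrite fsum_repr fsum_val_scale. Qed.

Definition tens (v : V) (w : W) : tensor := \pi_tensor [:: (v, w)].

Lemma fsum_repr_tens (U : lmodType K) (b : {bilinear V -> W -> U}) v w :
  fsum_val b (repr (tens v w)) = b v w.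
Proof. by rewrite fsum_repr /fsum_val big_seq1. Qed.

Lemma tens_bilinear : bilinear_for *:%R *:%R tens.
Proof.
split=> [w a u v|v a u w]; apply: tensor_eq => U b.
  by rewrite fsum_reprD fsum_reprZ !fsum_repr_tens linearPl.
by rewrite fsum_reprD fsum_reprZ !fsum_repr_tens linearPr.
Qed.

HB.instance Definition _ :=
  bilinear_isBilinear.Build K V W tensor *:%R *:%R tens tens_bilinear.

Lemma tensor_sum (x : tensor) : x = \sum_(p <- repr x) tens p.1 p.2.
Proof.
rewrite -{1}[x]reprK; elim: (repr x) => [|[v w] s IHs]; first by rewrite big_nil.
rewrite big_cons -IHs; apply: tensor_eq => U b.
by rewrite fsum_reprD fsum_repr_tens !fsum_repr {1}/fsum_val big_cons.
Qed.

Definition tensor_lift (U : lmodType K) (b : {bilinear V -> W -> U})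
  (x : tensor) : U := fsum_val b (repr x).

Lemma tensor_lift_linear (U : lmodType K) (b : {bilinear V -> W -> U}) : linear (tensor_lift b).
Proof. by move=> a x y; rewrite /tensor_lift fsum_reprD fsum_reprZ. Qed.

HB.instance Definition _ (U : lmodType K) (b : {bilinear V -> W -> U}) :=
  GRing.isLinear.Build K tensor U *:%R (tensor_lift b) (tensor_lift_linear b).

Lemma tensor_liftE (U : lmodType K) (b : {bilinear V -> W -> U}) v w :
  tensor_lift b (tens v w) = b v w.
Proof. exact: fsum_repr_tens. Qed.

Lemma tensor_lift_unique (U : lmodType K) (b : {bilinear V -> W -> U})
    (f : {linear tensor -> U}) :
  (forall v w, f (tens v w) = b v w) -> f =1 tensor_lift b.
Proof.
move=> fE x; rewrite [in LHS](tensor_sum x) linear_sum.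
by apply: eq_bigr => p _; rewrite fE.
Qed.

End Tensor.

(* The norm and completeness are spelled out, since the normed modules of
   MathComp-Analysis have no join with algebras. *)
HB.mixin Record isCStarAlgebra (R : realType) A & GRing.Algebra R[i] A := {
  star : A -> A;
  cnorm : A -> R;
  starD : forall x y, star (x + y) = star x + star y;
  starZ : forall (a : R[i]) x, star (a *: x) = a^*%R *: star x;
  starM : forall x y, star (x * y) = star y * star x;
  starK : forall x, star (star x) = x;
  cnorm_eq0 : forall x, cnorm x = 0 -> x = 0;
  cnormD : forall x y, cnorm (x + y) <= cnorm x + cnorm y;
  cnormZ : forall (a : R[i]) x, cnorm (a *: x) = normc a * cnorm x;
  cnormM : forall x y, cnorm (x * y) <= cnorm x * cnorm y;
  cnorm_starM : forall x, cnorm (star x * x) = cnorm x ^+ 2;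
  cnorm_complete : forall u : nat -> A,
    (forall e : R, 0 < e -> exists N, forall m n, (N <= m)%N -> (N <= n)%N ->
       cnorm (u m - u n) < e) ->
    exists l, forall e : R, 0 < e -> exists N, forall n, (N <= n)%N ->
       cnorm (u n - l) < e
}.

#[short(type="cstarAlgType")]
HB.structure Definition CStarAlgebra (R : realType) :=
  {A of GRing.Algebra R[i] A & isCStarAlgebra R A}.

(* The positive elements of the C*-algebra M_n(A) are the Y^* Y. *)
Definition cstar_mxpos (R : realType) (A : cstarAlgType R) n (x : 'M[A]_n) : Prop :=
  exists y : 'M[A]_n, x = (map_mx (@star R A) y)^T *m y.

(* A unital *-closed subspace of a unital C*-algebra (which by Gelfand-Naimark
   is a subalgebra of some B(H)), given as the image of an injective linear map;
   the matrix cones are those of the ambient algebra. *)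

Record opsys (R : realType) := OpSys {
  os_sort :> lmodType R[i];
  os_amb : cstarAlgType R;
  os_emb : {linear os_sort -> os_amb};
  os_emb_inj : injective os_emb;
  os_unit : os_sort;
  os_emb_unit : os_emb os_unit = 1;
  os_emb_star : forall x, exists y, os_emb y = star (os_emb x)
}.

Definition os_pos (R : realType) (S : opsys R) n (x : 'M[S]_n) : Prop :=
  cstar_mxpos (map_mx (os_emb S) x).

Lemma cstar_emb_star (R : realType) (A : cstarAlgType R) (x : A) :
  exists y : A, idfun y = star (idfun x).
Proof. by exists (star x). Qed.

Definition cstar_opsys (R : realType) (A : cstarAlgType R) : opsys R :=
  @OpSys R A A idfun (@inj_id A) 1 erefl (@cstar_emb_star R A).

(* Positivity in M_r(M_k) = B(C^k + ... + C^k).  In R[i], [0 <= z] says that z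
   is real and nonnegative. *)
Definition mxpos (R : realType) r k (B : 'M['M[R[i]]_k]_r) : Prop :=
  forall v : 'I_r -> 'cV[R[i]]_k,
    0 <= \sum_i \sum_j ((map_mx Num.conj (v i))^T *m B i j *m v j) 0 0.

Definition ucp (R : realType) (S : opsys R) p (phi : {linear S -> 'M[R[i]]_p}) : Prop :=
  phi (os_unit S) = 1%:M /\
  forall n (x : 'M[S]_n), os_pos x -> mxpos (map_mx phi x).

Section TensorCones.
Variables (R : realType) (S T : opsys R).

Definition tens_mx p q (phi : {linear S -> 'M[R[i]]_p})
  (psi : {linear T -> 'M[R[i]]_q}) (s : S) (t : T) : 'M[R[i]]_(p * q) :=
  tensmx (phi s) (psi t).

Lemma tens_mx_bilinear p q phi psi :
  bilinear_for *:%R *:%R (@tens_mx p q phi psi).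
Proof.
split=> [t a x y|s a x y]; rewrite /tens_mx; apply/matrixP=> i j.
  by rewrite linearP !mxE mulrDl mulrA.
by rewrite linearP !mxE mulrDr mulrCA.
Qed.

HB.instance Definition _ p q phi psi :=
  bilinear_isBilinear.Build R[i] S T 'M[R[i]]_(p * q) *:%R *:%R
    (@tens_mx p q phi psi) (@tens_mx_bilinear p q phi psi).

Definition tensor_map p q (phi : {linear S -> 'M[R[i]]_p})
  (psi : {linear T -> 'M[R[i]]_q}) : {linear tensor S T -> 'M[R[i]]_(p * q)} :=
  tensor_lift (tens_mx phi psi).

Definition min_pos r (x : 'M[tensor S T]_r) : Prop :=
  forall p q (phi : {linear S -> 'M[R[i]]_p}) (psi : {linear T -> 'M[R[i]]_q}),
    ucp phi -> ucp psi -> mxpos (map_mx (tensor_map phi psi) x).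

Definition tensor_mx p q (s : 'M[S]_p) (t : 'M[T]_q) : 'M[tensor S T]_(p * q) :=
  \matrix_(i, j) tens (s (mxtens_unindex i).1 (mxtens_unindex j).1)
                      (t (mxtens_unindex i).2 (mxtens_unindex j).2).

(* X^* Y X, for a scalar matrix X and a matrix Y of vectors *)
Definition compression (V : lmodType R[i]) m r (X : 'M[R[i]]_(m, r)) (y : 'M[V]_m) :
    'M[V]_r :=
  \matrix_(k, l) \sum_i \sum_j ((X i k)^*%R * X j l) *: y i j.

Definition max_pre r (y : 'M[tensor S T]_r) : Prop :=
  exists (p q : nat) (s : 'M[S]_p) (t : 'M[T]_q) (X : 'M[R[i]]_(p * q, r)),
    [/\ os_pos s, os_pos t & y = compression X (tensor_mx s t)].

Definition max_pos r (y : 'M[tensor S T]_r) : Prop :=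
  forall e : R, 0 < e ->
    max_pre (y + (e%:C *: tens (os_unit S) (os_unit T))%:M).

End TensorCones.

Definition mxcones (V : Type) := forall r, 'M[V]_r -> Prop.

Definition completely_positive (R : realType) (V W : lmodType R[i])
  (P : mxcones V) (Q : mxcones W) (f : {linear V -> W}) : Prop :=
  forall r (x : 'M[V]_r), P r x -> Q r (map_mx f x).

Definition complete_order_iso (R : realType) (V W : lmodType R[i])
  (P : mxcones V) (Q : mxcones W) (f : {linear V -> W}) : Prop :=
  exists g : {linear W -> V},
    [/\ cancel f g, cancel g f,
        completely_positive P Q f & completely_positive Q P g].

Definition cstar_nuclear (R : realType) (S : opsys R) : Prop :=
  forall A : cstarAlgType R,
    complete_order_iso (@min_pos R S (cstar_opsys A))
      (@max_pos R S (cstar_opsys A)) idfun.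

Section Linf4.
Variable R : realType.

Definition linf4 := {ffun 'I_4 -> R[i]}.
HB.instance Definition _ := GRing.PzRing.on linf4.
HB.instance Definition _ := GRing.Lmodule.on linf4.

Lemma linf4_oner_neq0 : (1 : linf4) != 0.
Proof. by apply/eqP => /ffunP/(_ 0)/eqP; rewrite !ffunE oner_eq0. Qed.

HB.instance Definition _ :=
  GRing.PzSemiRing_isNonZero.Build linf4 linf4_oner_neq0.

Lemma linf4_scaleAl (a : R[i]) (x y : linf4) : a *: (x * y) = (a *: x) * y.
Proof. by apply/ffunP => k; rewrite !ffunE [LHS]mulrA. Qed.

HB.instance Definition _ := GRing.Lmodule_isLalgebra.Build R[i] linf4 linf4_scaleAl.

Lemma linf4_scaleAr (a : R[i]) (x y : linf4) : a *: (x * y) = x * (a *: y).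
Proof. by apply/ffunP => k; rewrite !ffunE [LHS]mulrCA. Qed.

HB.instance Definition _ := GRing.Lalgebra_isAlgebra.Build R[i] linf4 linf4_scaleAr.

Definition linf4_star (x : linf4) : linf4 := [ffun k => (x k)^*%R].
Definition linf4_norm (x : linf4) : R := \big[Num.max/0]_k normc (x k).

Implicit Types x y : linf4.

Lemma linf4_starD x y : linf4_star (x + y) = linf4_star x + linf4_star y.
Proof. by apply/ffunP => k; rewrite !ffunE rmorphD. Qed.

Lemma linf4_starZ (a : R[i]) x : linf4_star (a *: x) = a^*%R *: linf4_star x.
Proof. by apply/ffunP => k; rewrite !ffunE rmorphM. Qed.

Lemma linf4_starM x y : linf4_star (x * y) = linf4_star y * linf4_star x.
Proof. by apply/ffunP => k; rewrite !ffunE rmorphM mulrC. Qed.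

Lemma linf4_starK x : linf4_star (linf4_star x) = x.
Proof. by apply/ffunP => k; rewrite !ffunE conjCK. Qed.

Lemma normc_ge0 (z : R[i]) : 0 <= normc z.
Proof. by case: z => a b; exact: sqrtr_ge0. Qed.

Lemma normc_star (z : R[i]) : normc (z^*)%R = normc z.
Proof. by case: z => a b /=; rewrite sqrrN. Qed.

Lemma normc_Re (z : R[i]) : `|complex.Re z| <= normc z.
Proof. by case: z => a b /=; rewrite -sqrtr_sqr ler_wsqrtr ?lerDl ?sqr_ge0. Qed.

Lemma normc_Im (z : R[i]) : `|complex.Im z| <= normc z.
Proof. by case: z => a b /=; rewrite -sqrtr_sqr ler_wsqrtr ?lerDr ?sqr_ge0. Qed.

Lemma normc_le (z : R[i]) : normc z <= `|complex.Re z| + `|complex.Im z|.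
Proof.
case: z => a b /=; rewrite -[leRHS]ger0_norm ?addr_ge0// -sqrtr_sqr.
rewrite ler_wsqrtr // sqrrD !real_normK ?num_real// -addrA lerD2l lerDr.
by rewrite mulrn_wge0 ?mulr_ge0.
Qed.

Lemma normc_le_linf4 x k : normc (x k) <= linf4_norm x.
Proof. exact: (@le_bigmax _ _ _ _ (fun k => normc (x k))). Qed.

Lemma linf4_norm_ge0 x : 0 <= linf4_norm x.
Proof. exact: le_trans (normc_ge0 _) (normc_le_linf4 x 0). Qed.

Lemma linf4_norm_le x r : 0 <= r -> (forall k, normc (x k) <= r) -> linf4_norm x <= r.
Proof. by move=> r0 h; apply: bigmax_le => // k _; exact: h. Qed.

Lemma linf4_norm_lt x r : 0 < r -> (forall k, normc (x k) < r) -> linf4_norm x < r.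
Proof. by move=> r0 h; apply: bigmax_lt => // k _; exact: h. Qed.

Lemma linf4_norm_eq0 x : linf4_norm x = 0 -> x = 0.
Proof.
move=> x0; apply/ffunP => k; rewrite ffunE; apply: eq0_normc.
by apply/eqP; rewrite eq_le normc_ge0 -x0 normc_le_linf4.
Qed.

Lemma linf4_normD x y : linf4_norm (x + y) <= linf4_norm x + linf4_norm y.
Proof.
apply: linf4_norm_le => [|k]; first by rewrite addr_ge0 ?linf4_norm_ge0.
by rewrite ffunE (le_trans (le_normcD _ _))// lerD ?normc_le_linf4.
Qed.

Lemma linf4_normM x y : linf4_norm (x * y) <= linf4_norm x * linf4_norm y.
Proof.
apply: linf4_norm_le => [|k]; first by rewrite mulr_ge0 ?linf4_norm_ge0.
by rewrite ffunE normcM ler_pM ?normc_ge0 ?normc_le_linf4.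
Qed.

Lemma linf4_normZ (a : R[i]) x : linf4_norm (a *: x) = normc a * linf4_norm x.
Proof.
apply/eqP; rewrite eq_le; apply/andP; split.
  apply: linf4_norm_le => [|k]; first by rewrite mulr_ge0 ?normc_ge0 ?linf4_norm_ge0.
  by rewrite ffunE normcM ler_wpM2l ?normc_ge0 ?normc_le_linf4.
have [->|a0] := eqVneq a 0; first by rewrite normc0 mul0r linf4_norm_ge0.
have na0 : 0 < normc a.
  by rewrite lt_def normc_ge0 andbT; apply: contra a0 => /eqP/eq0_normc ->.
rewrite mulrC -ler_pdivlMr//; apply: linf4_norm_le => [|k].
  by rewrite divr_ge0 ?linf4_norm_ge0 ?ltW.
by rewrite ler_pdivlMr// mulrC -normcM; have := normc_le_linf4 (a *: x) k; rewrite ffunE.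
Qed.

Lemma linf4_norm_starM x : linf4_norm (linf4_star x * x) = linf4_norm x ^+ 2.
Proof.
have E k : normc ((linf4_star x * x) k) = normc (x k) ^+ 2.
  by rewrite !ffunE normcM normc_star.
apply/eqP; rewrite eq_le; apply/andP; split.
  apply: linf4_norm_le => [|k]; first by rewrite sqr_ge0.
  by rewrite E ler_sqr ?nnegrE ?normc_ge0 ?linf4_norm_ge0 ?normc_le_linf4.
rewrite -[leRHS]sqr_sqrtr ?linf4_norm_ge0// ler_sqr ?nnegrE ?sqrtr_ge0 ?linf4_norm_ge0//.
apply: linf4_norm_le => [|k]; first exact: sqrtr_ge0.
by rewrite -[leLHS]ger0_norm ?normc_ge0// -sqrtr_sqr ler_wsqrtr// -E normc_le_linf4.
Qed.

Lemma real_cauchy_converges (u : nat -> R) :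
  (forall e : R, 0 < e -> exists N, forall m n, (N <= m)%N -> (N <= n)%N ->
     `|u m - u n| < e) ->
  exists l, forall e : R, 0 < e -> exists N, forall n, (N <= n)%N -> `|u n - l| < e.
Proof.
move=> cu; pose E : set R := fun r => exists N, forall n, (N <= n)%N -> r <= u n.
have lowE e N : (forall m n, (N <= m)%N -> (N <= n)%N -> `|u m - u n| < e) ->
    E (u N - e) /\ ubound E (u N + e).
  move=> h; split.
    exists N => n Nn; have /ltW := h N n (leqnn _) Nn.
    by rewrite ler_norml => /andP[_]; rewrite lerBlDr lerBlDl addrC.
  move=> r [M hM]; apply: (le_trans (hM _ (leq_maxl M N))).
  have /ltW := h (maxn M N) N (leq_maxr _ _) (leqnn _).
  by rewrite ler_norml => /andP[_]; rewrite lerBlDl.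
have [N1 /lowE[E1 U1]] := cu 1 ltr01.
have supE : has_sup E by split; [exists (u N1 - 1) | exists (u N1 + 1)].
exists (sup E) => e e0; have e20 : 0 < e / 2 by rewrite divr_gt0.
have [N h] := cu _ e20; have [E2 U2] := lowE _ _ h.
exists N => n Nn; rewrite (splitr e).
rewrite (le_lt_trans (ler_distD (u N) _ _))// ltr_leD ?h//.
have h1 := @sup_upper_bound _ E supE _ E2.
have h2 := @ge_sup _ E _ (ex_intro _ _ E2) U2.
rewrite ler_norml lerBrDr addrC lerBlDr h2 /=.
by rewrite lerBlDr addrC -lerBlDr.
Qed.

Lemma linf4_complete (u : nat -> linf4) :
  (forall e : R, 0 < e -> exists N, forall m n, (N <= m)%N -> (N <= n)%N ->
     linf4_norm (u m - u n) < e) ->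
  exists l, forall e : R, 0 < e -> exists N, forall n, (N <= n)%N ->
     linf4_norm (u n - l) < e.
Proof.
move=> cu.
have cf (f : R[i] -> R) : (forall z, `|f z| <= normc z) ->
    {morph f : x y / x - y} -> forall k, exists l, forall e : R, 0 < e ->
    exists N, forall n, (N <= n)%N -> `|f (u n k) - l| < e.
  move=> fn fB k; apply: real_cauchy_converges => e /cu[N hN].
  exists N => m n Nm Nn; rewrite -fB; apply: le_lt_trans (hN m n Nm Nn).
  apply: (le_trans (fn _)); have := normc_le_linf4 (u m - u n) k.
  by rewrite !ffunE.
have ReB : {morph @complex.Re R : x y / x - y} by move=> [a b] [c d].
have ImB : {morph @complex.Im R : x y / x - y} by move=> [a b] [c d].
have /choice[lr hr] := cf _ normc_Re ReB.
have /choice[li hi] := cf _ normc_Im ImB.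
exists [ffun k => lr k +i* li k] => e e0.
have e20 : 0 < e / 2 by rewrite divr_gt0.
have /choice[Nr hNr] : forall k, exists N, forall n, (N <= n)%N ->
    `|complex.Re (u n k) - lr k| < e / 2 by move=> k; exact: hr.
have /choice[Ni hNi] : forall k, exists N, forall n, (N <= n)%N ->
    `|complex.Im (u n k) - li k| < e / 2 by move=> k; exact: hi.
exists (\max_k maxn (Nr k) (Ni k))%N => n Nn.
apply: linf4_norm_lt => // k; apply: (le_lt_trans (normc_le _)).
have : (maxn (Nr k) (Ni k) <= n)%N by apply: leq_trans Nn; exact: leq_bigmax.
rewrite geq_max => /andP[nr ni]; rewrite [ltRHS]splitr !ffunE ReB ImB.
by rewrite ltrD ?hNr ?hNi.
Qed.

HB.instance Definition _ := isCStarAlgebra.Build R linf4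
  linf4_starD linf4_starZ linf4_starM linf4_starK linf4_norm_eq0 linf4_normD
  linf4_normZ linf4_normM linf4_norm_starM linf4_complete.

End Linf4.

Section W22.
Variable R : realType.

(* The coordinates a_1, ..., a_4 are numbered from 0 here. *)
Definition W22_pred : {pred linf4 R} := fun a => a 0 + a 1 == a 2 + a 3.

Lemma W22_predE a : (a \in W22_pred) = (a 0 + a 1 == a 2 + a 3).
Proof. by []. Qed.

Lemma W22_submod_closed : submod_closed W22_pred.
Proof.
split=> [|a x y]; rewrite !W22_predE ?ffunE ?addr0//.
move=> /eqP xE /eqP yE; rewrite addrACA -scalerDr xE yE.
by rewrite scalerDr addrACA.
Qed.

HB.instance Definition _ :=
  GRing.isSubmodClosed.Build R[i] (linf4 R) W22_pred W22_submod_closed.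

Record W22_space := W22Space { W22_val : linf4 R; _ : W22_val \in W22_pred }.

HB.instance Definition _ := [isSub for W22_val].
HB.instance Definition _ := [Choice of W22_space by <:].
HB.instance Definition _ := [SubChoice_isSubLmodule of W22_space by <:].

Definition W22_emb : {linear W22_space -> linf4 R} := val.

Lemma W22_unit_subproof : (1 : linf4 R) \in W22_pred.
Proof. by rewrite W22_predE !ffunE. Qed.

Definition W22_unit : W22_space := W22Space W22_unit_subproof.

Lemma W22_star_subproof (x : W22_space) : exists y, W22_emb y = star (W22_emb x).
Proof.
case: x => x xW; suff xs : star x \in W22_pred by exists (W22Space xs).
move: xW; rewrite !W22_predE => /eqP xE.
by rewrite !ffunE -!rmorphD xE.
Qed.

Definition W22 : opsys R :=
  @OpSys R W22_space (linf4 R) W22_emb val_inj W22_unit erefl W22_star_subproof.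

End W22.

(* Main.v *)
(* Two independent facts are needed.

   (1) A matrix [a] over a C*-algebra [A] that is positive under all ucp maps into
   matrices is self-adjoint and [a + t] is a sum of hermitian squares for all
   [t > 0].  Otherwise Hahn-Banach (a maximal wedge) gives a separating positive
   functional on [M_r(A)]; its Choi matrix is a completely positive map
   [A -> M_r], which is normalised to a ucp map after a small perturbation.
   Self-adjointness uses that [y^* y] is positive in [A] (Kelley-Vaught).

   (2) Let [a_1 + a_2 = a_3 + a_4 = c] be sums of hermitian squares in [M_r(A)] with
   [c] invertible, and put [u = a_1 - a_2], [v = a_3 - a_4].  There are columns
   [b_0, b_1, ...] over [A] with [b_j^* b_j = c] and [b_j^* b_(j+1)] equal to [u] or [v]
   according to the parity of [j].  With [e = (1,-1,0,0)] and [f = (0,0,1,-1)], the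
   path matrix over [W_{2,2}] with diagonal [1] and alternating entries [e], [f] is
   positive, being a sum of [2 x 2] blocks [1 +- 1] in each coordinate.  Pairing it
   with the Gram matrix of the [b_j] is, up to scaling and a boundary term that
   vanishes as the path grows, [1 (x) c + e (x) u + f (x) v = 2 (a_1, ..., a_4)].
   This is a Folner argument for the infinite dihedral group. *)
From HB Require Import structures.
From mathcomp Require Import all_boot all_order all_algebra.
From mathcomp Require Import boolp classical_sets reals complex mxtens.
From mathcomp Require Import zify ring lra.
Require Import Defs.

Set Implicit Arguments.
Unset Strict Implicit.
Unset Printing Implicit Defensive.

Import Order.TTheory GRing.Theory Num.Theory.
Import Normc.

Local Open Scope ring_scope.
Local Open Scope complex_scope.

(** * Norm, inverses and square roots in a C*-algebra *)

Section CStar.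
Variables (R : realType) (A : cstarAlgType R).
Implicit Types (x y z h s c : A) (t e : R).

(** Functional calculus is avoided throughout. In [A] it is replaced by a fixed-point square root of
    [h + e] that keeps track of commutation; in [M_r(A)] no root is taken, only the inverse [g] of
    [c], which is why the defects of the chain read [c - w g w]. With [c] normalised to 1 they would
    be [1 - w^2] for self-adjoint contractions [u] and [v], and the chain a walk on the Cayley graph
    of [Z/2 * Z/2]. That graph is a line, so a path on [n] vertices loses only the proportion
    [2 / n] of one of the two kinds of edges. The slack [e (1 (x) 1)] in the maximal cone does two
    jobs: it makes [c] invertible, and it lets [a_3] and [a_4] be moved slightly apart, so that the
    loss is compensated exactly at a finite length. *)

Lemma normc_real t : normc t%:C = `|t|.
Proof. by rewrite /= expr0n addr0 sqrtr_sqr. Qed.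

Lemma cnorm_rscale t x : cnorm (t%:C *: x) = `|t| * cnorm x.
Proof. by rewrite cnormZ normc_real. Qed.

Lemma bernoulli t n : 0 <= t -> 1 + n%:R * t <= (1 + t) ^+ n.
Proof.
move=> t0; elim: n => [|n IH]; first by rewrite mul0r addr0.
have n0 : 0 <= n%:R :> R by [].
rewrite exprS mulrDl mul1r -natr1; have : 0 <= n%:R * t * t by rewrite !mulr_ge0.
have := ler_wpM2l t0 IH; nra.
Qed.

Lemma geometric_small (r e : R) : 0 <= r < 1 -> 0 < e -> exists N, r ^+ N < e.
Proof.
case/andP=> r0 r1 e0; have [->|rn0] := eqVneq r 0; first by exists 1; rewrite expr1.
have rp : 0 < r by rewrite lt_def rn0.
have t0 : 0 < r^-1 - 1 by rewrite subr_gt0 invf_gt1.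
have := archi_boundP (ltW (divr_gt0 (_ : 0 < e^-1) t0)).
rewrite invr_gt0 => /(_ e0); set N := Num.Def.archi_bound _ => hN; exists N.
have := bernoulli N (ltW t0); rewrite [1 + (_ - 1)]addrC subrK => hB.
rewrite -[r ^+ N]invrK -[ltRHS]invrK ltf_pV2 ?posrE ?invr_gt0 ?exprn_gt0 //.
rewrite -exprVn; apply: lt_le_trans hB.
by move: hN; rewrite ltr_pdivrMr // => /lt_trans; apply; rewrite ltrDr.
Qed.

Lemma cnorm0 : cnorm (0 : A) = 0.
Proof. by rewrite -(scale0r (0 : A)) cnormZ normc0 mul0r. Qed.

Lemma cnormN x : cnorm (- x) = cnorm x.
Proof.
have -> : - x = ((-1 : R)%:C) *: x by rewrite rmorphN1 scaleN1r.
by rewrite cnorm_rscale normrN normr1 mul1r.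
Qed.

Lemma cnormBC x y : cnorm (x - y) = cnorm (y - x).
Proof. by rewrite -cnormN opprB. Qed.

Lemma cnorm_ge0 x : 0 <= cnorm x.
Proof. by have := cnormD x (- x); rewrite subrr cnorm0 cnormN; lra. Qed.

Lemma cnormB x y : cnorm (x - y) <= cnorm x + cnorm y.
Proof. by rewrite -(cnormN y) cnormD. Qed.

Lemma cnorm_triangle z x y : cnorm (x - y) <= cnorm (x - z) + cnorm (z - y).
Proof. by rewrite -[x - y](subrKA z) cnormD. Qed.

Lemma cnorm_star_le x : cnorm x <= cnorm (star x).
Proof.
have := cnormM (star x) x; rewrite cnorm_starM expr2.
have [->|x0] := eqVneq (cnorm x) 0; first by rewrite cnorm_ge0.
by rewrite ler_pM2r // lt_def x0 cnorm_ge0.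
Qed.

Lemma cnorm_star x : cnorm (star x) = cnorm x.
Proof.
by apply/eqP; rewrite eq_le cnorm_star_le -{2}(starK x) cnorm_star_le.
Qed.

Lemma star_is_zmod_morphism : zmod_morphism (@star R A).
Proof.
move=> x y; apply: (addIr (star y)); rewrite subrK -starD subrK //.
Qed.

HB.instance Definition _ :=
  GRing.isZmodMorphism.Build A A (@star R A) star_is_zmod_morphism.

Lemma star1 : star (1 : A) = 1.
Proof. by have := starM (star 1) (1 : A); rewrite mulr1 starK mulr1. Qed.

Lemma star_rscale t x : star (t%:C *: x) = t%:C *: star x.
Proof. by rewrite starZ (conjc_real t : (t%:C)^*%R = _). Qed.

Lemma starX x n : star (x ^+ n) = star x ^+ n.
Proof. by elim: n => [|n IH]; rewrite ?star1 // exprS starM IH exprSr. Qed.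

Lemma cnorm1 : cnorm (1 : A) = 1.
Proof.
have := cnorm_starM (1 : A); rewrite star1 mulr1 expr2 => /eqP.
rewrite eq_sym -subr_eq0 -[X in _ - X]mulr1 -mulrBr mulf_eq0 subr_eq0.
by case/orP => /eqP // /cnorm_eq0 /eqP; rewrite oner_eq0.
Qed.

Lemma cnorm_scalar t : 0 <= t -> cnorm (t%:C *: 1 : A) = t.
Proof. by move=> t0; rewrite cnorm_rscale cnorm1 mulr1 ger0_norm. Qed.

Lemma cnorm_small x K : (forall e, 0 < e -> cnorm x <= K * e) -> x = 0.
Proof.
move=> h; apply: cnorm_eq0; apply/eqP; rewrite eq_le cnorm_ge0 andbT.
have K0 : 0 < `|K| + 1 by rewrite ltr_pwDr.
apply/ler_addgt0Pl => e e0; rewrite addr0.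
apply: le_trans (h _ (divr_gt0 e0 K0)) _.
rewrite mulrA ler_pdivrMr // mulrC ler_wpM2l ?(ltW e0) //.
by rewrite (le_trans (ler_norm K)) // lerDl.
Qed.

Lemma contraction_limit (u : nat -> A) (r : R) : 0 <= r < 1 ->
  (forall n, cnorm (u n.+2 - u n.+1) <= r * cnorm (u n.+1 - u n)) ->
  exists l, forall e, 0 < e -> exists N, forall n, (N <= n)%N -> cnorm (u n - l) < e.
Proof.
case/andP=> r0 r1 h; set d := cnorm (u 1 - u 0).
have step n : cnorm (u n.+1 - u n) <= r ^+ n * d.
  elim: n => [|n IH]; first by rewrite mul1r.
  by rewrite (le_trans (h n)) // exprS -mulrA ler_wpM2l.
have tail n k : cnorm (u (n + k)%N - u n) <= (r ^+ n - r ^+ (n + k)) * (d / (1 - r)).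
  elim: k => [|k IH]; first by rewrite addn0 !subrr cnorm0 mul0r.
  rewrite addnS (le_trans (cnorm_triangle (u (n + k)%N) _ _)) //.
  rewrite (le_trans (lerD (step _) IH)) // exprS le_eqVlt; apply/orP; left.
  by apply/eqP; field; lra.
have tail' n m : (n <= m)%N -> cnorm (u m - u n) <= r ^+ n * (d / (1 - r)).
  move=> nm; rewrite -(subnKC nm) (le_trans (tail _ _)) // ler_wpM2r //.
    by rewrite divr_ge0 ?cnorm_ge0 //; lra.
  by rewrite lerBlDr lerDl exprn_ge0.
apply: cnorm_complete => e e0.
set K := d / (1 - r) + 1.
have K0 : 0 < K by rewrite /K ltr_wpDl // divr_ge0 ?cnorm_ge0 //; lra.
have [N hN] := geometric_small (introT andP (conj r0 r1))
   (divr_gt0 e0 (mulr_gt0 (ltr0Sn R 1) K0)).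
exists N => m n mN nN.
have small k : (N <= k)%N -> cnorm (u k - u N) < e / 2.
  move=> /tail' /le_lt_trans; apply.
  apply: le_lt_trans (_ : r ^+ N * K < _); first by rewrite ler_wpM2l ?exprn_ge0 // /K lerDl.
  by move: hN; rewrite ltr_pdivlMr ?mulr_gt0 // => hN; rewrite ltr_pdivlMr //; lra.
rewrite (le_lt_trans (cnorm_triangle (u N) _ _)) // (cnormBC (u N)).
by have := small _ mN; have := small _ nN; lra.
Qed.

(** Neumann series, run as the iteration [x |-> 1 + y x] from 0. The inverse is two-sided because
    the iterates, hence the limit, commute with [y]. *)
Lemma one_sub_inv y : cnorm y < 1 -> exists z, (1 - y) * z = 1 /\ z * (1 - y) = 1.
Proof.
move=> y1; pose u n := iter n (fun x => 1 + y * x) 0.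
have uS n : u n.+1 = 1 + y * u n by [].
have [|n|l hl] := @contraction_limit u (cnorm y); first by rewrite cnorm_ge0.
  by rewrite !uS opprD addrACA subrr add0r -mulrBr cnormM.
have uC n : y * u n = u n * y.
  elim: n => [|n IH]; first by rewrite mulr0 mul0r.
  by rewrite uS mulrDr mulrDl mulr1 mul1r {1}IH mulrA.
have lE : 1 + y * l = l.
  apply/subr0_eq/(@cnorm_small _ 2) => e /hl[N hN].
  have := hN N (leqnn _); have := hN N.+1 (leqnSn _); rewrite uS => h1 h2.
  apply: le_trans (cnorm_triangle (1 + y * u N) _ _) _.
  rewrite opprD addrACA subrr add0r -mulrBr.
  have := cnormM y (l - u N); rewrite (cnormBC l).
  have := ler_wpM2r (cnorm_ge0 (u N - l)) (ltW y1); lra.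
have lC : y * l = l * y.
  apply/subr0_eq/(@cnorm_small _ 2) => e /hl[N /(_ N (leqnn _)) h].
  apply: le_trans (cnorm_triangle (y * u N) _ _) _.
  rewrite {2}uC -mulrBr -mulrBl.
  have := cnormM y (l - u N); have := cnormM (u N - l) y; rewrite (cnormBC l).
  have := ler_wpM2r (cnorm_ge0 (u N - l)) (ltW y1); lra.
by exists l; rewrite mulrBl mulrBr mulr1 mul1r -lC -{1 3}lE addrK.
Qed.

(** The map [x |-> (y + x^2) / 2] contracts the ball of radius [|y|], and its fixed point [l]
    satisfies [(1 - l)^2 = 1 - y]. The commutation clause is inherited from the iterates. *)
Lemma one_sub_sqrt y : cnorm y < 1 -> star y = y ->
  exists s, [/\ star s = s, s * s = 1 - y & forall x, x * y = y * x -> x * s = s * x].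
Proof.
move=> y1 ys; pose h := (2^-1 : R)%:C; set r := cnorm y.
have r0 : 0 <= r by exact: cnorm_ge0.
have r1 : r < 1 by [].
pose u n := iter n (fun x => h *: (y + x * x)) 0.
have uS n : u n.+1 = h *: (y + u n * u n) by [].
have h2 x : h *: x + h *: x = x.
  rewrite -scalerDl -rmorphD /= (_ : _ + _ = 1 :> R) ?rmorph1 ?scale1r //; lra.
have cnormh x : cnorm (h *: x) = cnorm x / 2.
  by rewrite cnorm_rscale ger0_norm ?invr_ge0 // mulrC.
have un n : cnorm (u n) <= r.
  elim: n => [|n IH]; first by rewrite cnorm0.
  rewrite uS cnormh; have := cnormD y (u n * u n); have := cnormM (u n) (u n).
  have := cnorm_ge0 (u n); rewrite -/r => a0 a1 a2.
  have : cnorm (u n) * cnorm (u n) <= r * 1 by rewrite ler_pM // ltW // (le_lt_trans IH).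
  lra.
have sqB x z : cnorm x <= r -> cnorm z <= r ->
    cnorm (h *: (y + x * x) - h *: (y + z * z)) <= r * cnorm (x - z).
  move=> xr zr; rewrite -scalerBr cnormh opprD addrACA subrr add0r.
  have -> : x * x - z * z = x * (x - z) + (x - z) * z.
    by rewrite mulrBr mulrBl addrA subrK.
  have := cnormD (x * (x - z)) ((x - z) * z).
  have := cnormM x (x - z); have := cnormM (x - z) z.
  have := cnorm_ge0 (x - z); nra.
have [|n|l hl] := @contraction_limit u r; first by rewrite r0.
  by rewrite [u n.+2]uS [in X in _ - X]uS sqB.
have lr : cnorm l <= r.
  apply/ler_addgt0Pl => e /hl[N /(_ N (leqnn _)) lN].
  rewrite -[l](subKr (u N)); have := cnormB (u N) (u N - l); have := un N; lra.
have lE : h *: (y + l * l) = l.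
  apply/subr0_eq/(@cnorm_small _ 2) => e /hl[N hN].
  have := hN N (leqnn _); have := hN N.+1 (leqnSn _) => h1 h3.
  apply: le_trans (cnorm_triangle (u N.+1) _ _) _.
  have := sqB _ _ lr (un N); rewrite -uS (cnormBC l (u N)).
  have := ler_wpM2r (cnorm_ge0 (u N - l)) (ltW y1); rewrite -/r; lra.
exists (1 - l); split=> [||x xy].
- rewrite raddfB /= star1; congr (_ - _).
  have us n : star (u n) = u n.
    elim: n => [|n IH]; first by rewrite raddf0.
    by rewrite uS star_rscale starD starM IH ys.
  apply/subr0_eq/(@cnorm_small _ 2) => e /hl[N /(_ N (leqnn _)) lN].
  apply: le_trans (cnorm_triangle (u N) _ _) _.
  by rewrite -{1}us -raddfB cnorm_star (cnormBC l); lra.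
- have yE : y = l + l - l * l by rewrite -{1 2}lE h2 addrK.
  by rewrite mulrBl mul1r mulrBr mulr1 opprB [in RHS]yE !opprD opprK !addrA addrAC.
- have uC n : x * u n = u n * x.
    elim: n => [|n IH]; first by rewrite mulr0 mul0r.
    rewrite uS -scalerAr -scalerAl mulrDr mulrDl xy; congr (_ *: (_ + _)).
    by rewrite mulrA IH -mulrA IH mulrA.
  rewrite mulrBr mulrBl mulr1 mul1r; congr (_ - _).
  apply/subr0_eq/(@cnorm_small _ (2 * cnorm x)) => e /hl[N /(_ N (leqnn _)) lN].
  apply: le_trans (cnorm_triangle (x * u N) _ _) _.
  rewrite {2}uC -mulrBr -mulrBl.
  have := cnormM x (l - u N); have := cnormM (u N - l) x; rewrite (cnormBC l).
  have := ler_wpM2r (cnorm_ge0 x) (ltW lN); nra.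
Qed.
End CStar.

(** * Positive elements *)

Section Positive.
Variables (R : realType) (A : cstarAlgType R).
Implicit Types (x y z h s c b : A) (t e : R).

Definition cst t : A := t%:C *: 1.

Lemma cst_is_zmod_morphism : zmod_morphism cst.
Proof. by move=> s t; rewrite /cst rmorphB scalerBl. Qed.

Lemma cst_is_monoid_morphism : monoid_morphism cst.
Proof.
split=> [|s t]; rewrite /cst ?rmorph1 ?scale1r // rmorphM /=.
by rewrite -scalerAl mul1r scalerA.
Qed.

HB.instance Definition _ :=
  GRing.isZmodMorphism.Build R A cst cst_is_zmod_morphism.
HB.instance Definition _ :=
  GRing.isMonoidMorphism.Build R A cst cst_is_monoid_morphism.

Lemma cstD (u t : R) : cst u + cst t = cst (u + t). Proof. by rewrite rmorphD. Qed.
Lemma cstM (u t : R) : cst u * cst t = cst (u * t). Proof. by rewrite rmorphM. Qed.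

Lemma cst_mul t x : cst t * x = t%:C *: x.
Proof. by rewrite /cst -scalerAl mul1r. Qed.

Lemma cstC t x : cst t * x = x * cst t.
Proof. by rewrite cst_mul /cst -scalerAr mulr1. Qed.

Lemma star_cst t : star (cst t) = cst t.
Proof. by rewrite star_rscale star1. Qed.

Lemma cnorm_cst t : 0 <= t -> cnorm (cst t) = t.
Proof. exact: cnorm_scalar. Qed.

Lemma cnorm_cstM t x : cnorm (cst t * x) = `|t| * cnorm x.
Proof. by rewrite cst_mul cnorm_rscale. Qed.

(* For self-adjoint [x] this is the norm form of [spectrum x >= 0]; it avoids
   functional calculus. *)
Definition pos x := star x = x /\ exists t, cnorm (cst t - x) <= t.

Lemma pos_star x : pos x -> star x = x. Proof. by case. Qed.

Lemma posD x y : pos x -> pos y -> pos (x + y).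
Proof.
move=> [sx [t xt]] [sy [s ys]]; split; first by rewrite starD sx sy.
exists (t + s); rewrite rmorphD opprD addrACA.
by apply: le_trans (cnormD _ _) _; rewrite lerD.
Qed.

Lemma pos_cst t : 0 <= t -> pos (cst t).
Proof. by move=> t0; split; [exact: star_cst | exists t; rewrite subrr cnorm0]. Qed.

Lemma pos0 : pos 0.
Proof. by rewrite -(rmorph0 cst); apply: pos_cst. Qed.

Lemma posZ t x : 0 <= t -> pos x -> pos (cst t * x).
Proof.
move=> t0 [sx [s xs]]; split; first by rewrite starM star_cst sx cstC.
by exists (t * s); rewrite rmorphM -mulrBr cnorm_cstM ger0_norm // ler_wpM2l.
Qed.

Lemma pos_sum (I : Type) (r : seq I) (P : pred I) (F : I -> A) :
  (forall i, P i -> pos (F i)) -> pos (\sum_(i <- r | P i) F i).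
Proof. by move=> h; apply: big_ind => //; [exact: pos0 | exact: posD]. Qed.

Lemma pos_bound h t : star h = h -> cnorm h <= t -> pos (cst t - h).
Proof.
move=> sh ht; split; first by rewrite raddfB /= star_cst sh.
by exists t; rewrite subKr.
Qed.

(** If [|t - h| <= t], then [h + e = (t + e) (1 - y)] with [y = (t + e)^-1 (t - h)] of norm at most
    [t / (t + e)]; the [e] makes this less than 1. *)
Lemma pos_sqrt h e : pos h -> 0 < e ->
  exists s, [/\ star s = s, s * s = h + cst e & forall x, x * h = h * x -> x * s = s * x].
Proof.
move=> [sh [t ht]] e0; have t0 : 0 <= t by exact: le_trans (cnorm_ge0 _) ht.
have te : 0 < t + e by lra.
pose y := cst (t + e)^-1 * (cst t - h).
have [||s [ss sE sC]] := @one_sub_sqrt _ _ y.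
- rewrite /y cnorm_cstM ger0_norm ?invr_ge0 ?ltW // mulrC ltr_pdivrMr //; lra.
- by rewrite /y starM star_cst raddfB /= star_cst sh cstC.
exists (cst (Num.sqrt (t + e)) * s); split.
- by rewrite starM star_cst ss cstC.
- rewrite mulrA -(mulrA (cst _) s) -cstC mulrA cstM -expr2 sqr_sqrtr ?ltW //.
  rewrite -mulrA sE /y mulrBr mulr1 mulrA cstM divff ?lt0r_neq0 // rmorph1.
  by rewrite mul1r opprB addrCA rmorphD addrAC subrr add0r.
- move=> x xh; rewrite mulrA -cstC -!mulrA sC // /y.
  by rewrite mulrA -cstC -!mulrA mulrBr mulrBl xh -cstC.
Qed.

(* [U = h + i s] satisfies [U^* U = h^2 + s^2] and [h = (U + U^* ) / 2]. *)
Lemma cnorm_le_sum_sqr h s : star h = h -> star s = s -> h * s = s * h ->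
  cnorm h ^+ 2 <= cnorm (h * h + s * s).
Proof.
move=> sh ss hs; pose j : R[i] := 'i.
have jc : j^*%R = - j by apply/eqP; rewrite eq_complex /= oppr0 !eqxx.
have jj : j * j = -1 by rewrite -expr2 sqr_i.
pose U := h + j *: s; have sU : star U = h - j *: s.
  by rewrite starD starZ jc sh ss scaleNr.
have UU : star U * U = h * h + s * s.
  rewrite sU /U mulrBl !mulrDr -!scalerAl -!scalerAr scalerA jj hs scaleN1r.
  by rewrite opprD opprK addrACA addrA subrK.
rewrite -UU cnorm_starM ler_sqr ?nnegrE ?cnorm_ge0 //.
have : cnorm (cst 2 * h) <= 2 * cnorm U.
  have -> : cst 2 * h = U + star U.
    by rewrite sU /U addrACA subrr addr0 cst_mul rmorph_nat scaler_nat.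
  by apply: le_trans (cnormD _ _) _; rewrite cnorm_star mulr_natl.
by rewrite cnorm_cstM ger0_norm // ler_pM2l.
Qed.

(** Scale [x] to [b] with [|b^2| < 1] and let [s^2 = 1 - b^2]. Then [s^2 + b^2 = 1] forces
    [|s| <= 1], and [K - x^2 = K s^2] has norm at most [K]. *)
Lemma pos_sqr x : star x = x -> pos (x * x).
Proof.
move=> sx; pose K := cnorm x ^+ 2 + 1; pose k := Num.sqrt K^-1.
have K0 : 0 < K by rewrite ltr_wpDl ?exprn_ge0 ?cnorm_ge0.
have kk : k * k = K^-1 by rewrite -expr2 sqr_sqrtr ?invr_ge0 ?ltW.
pose b := cst k * x; have sb : star b = b by rewrite starM star_cst sx -cstC.
have bb : b * b = cst K^-1 * (x * x).
  by rewrite /b -!mulrA (mulrA x) -cstC !mulrA cstM kk.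
have [||s [ss sE sC]] := @one_sub_sqrt _ _ (b * b).
- rewrite bb cnorm_cstM ger0_norm ?invr_ge0 ?ltW // mulrC ltr_pdivrMr // mul1r.
  by apply: le_lt_trans (cnormM _ _) _; rewrite /K -expr2 ltrDl.
- by rewrite starM sb.
have h : cnorm s ^+ 2 <= 1.
  rewrite -(@cnorm1 _ A); have -> : 1 = s * s + b * b by rewrite sE subrK.
  by apply: cnorm_le_sum_sqr => //; rewrite sC ?mulrA.
split; first by rewrite starM sx.
exists K; have -> : cst K - x * x = cst K * (star s * s).
  rewrite ss sE bb mulrBr mulr1 (mulrA (cst K)) cstM divff ?lt0r_neq0 //.
  by rewrite rmorph1 mul1r.
by rewrite cnorm_cstM gtr0_norm // cnorm_starM -[leRHS]mulr1 ler_pM2l.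
Qed.

(** The roots [s1^2 = t - h + e] and [s2^2 = t + h + e] commute with each other and with [h], so
    [h^2 + (s1 s2)^2 = (t + e)^2], whose norm dominates [|h|^2]. *)
Lemma cnorm_le_of_pos h t : 0 <= t -> star h = h ->
  pos (cst t - h) -> pos (cst t + h) -> cnorm h <= t.
Proof.
move=> t0 sh p1 p2; apply/ler_addgt0Pl => e e0.
have [s1 [ss1 s1E s1C]] := pos_sqrt p1 e0.
have [s2 [ss2 s2E s2C]] := pos_sqrt p2 e0.
have h1 : h * s1 = s1 * h by apply: s1C; rewrite mulrBr mulrBl cstC.
have h2 : h * s2 = s2 * h by apply: s2C; rewrite mulrDr mulrDl cstC.
have s12 : s1 * s2 = s2 * s1.
  by apply: s2C; rewrite mulrDr mulrDl -cstC h1.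
have := @cnorm_le_sum_sqr h (s1 * s2) sh.
rewrite starM ss1 ss2 s12 => /(_ erefl); rewrite mulrA h2 -!mulrA h1 => /(_ erefl).
have -> : h * h + s2 * (s1 * (s2 * s1)) = cst ((t + e) ^+ 2).
  rewrite -s12 (mulrA s1) s1E mulrA -(mulrA s2).
  have -> : (cst t - h + cst e) * s2 = s2 * (cst t - h + cst e).
    by rewrite mulrDl mulrDr mulrBl mulrBr -!cstC h2.
  rewrite mulrA s2E [cst t + h + _]addrAC [cst t - h + _]addrAC cstD.
  by rewrite mulrDl !mulrBr -(cstC _ h) (addrA (_ - _)) subrK subrKC expr2 cstM.
by rewrite cnorm_cst ?sqr_ge0 // ler_sqr ?nnegrE ?cnorm_ge0 // ?(addrC e) ?addr_ge0 // ltW.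
Qed.

Lemma pos_norm h t : pos h -> cnorm h <= t -> cnorm (cst t - h) <= t.
Proof.
move=> ph ht; have t0 := le_trans (cnorm_ge0 _) ht; have sh := pos_star ph.
apply: cnorm_le_of_pos => //; first by rewrite raddfB /= star_cst sh.
  by rewrite subKr.
by apply: posD; [apply: pos_cst | apply: pos_bound].
Qed.

Lemma pos_closed h : (forall e, 0 < e -> pos (h + cst e)) -> pos h.
Proof.
move=> ph; have sh : star h = h.
  by have [+ _] := ph _ ltr01; rewrite starD star_cst => /addIr.
split=> //; exists (cnorm h); apply/ler_addgt0Pl => e e0.
have he : cnorm (h + cst e) <= e + cnorm h.
  by have := cnormD h (cst e); rewrite (cnorm_cst (ltW e0)) [leRHS]addrC.
have := pos_norm (ph _ e0) he.
by rewrite rmorphD opprD addrACA [cst e + _]addrC addrACA subrr addr0 addrC.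
Qed.

(** Let [r^2 = c + e / n] with [n > |b^2|]. Then [b c b + e = (b r)^2 + (e / n) (n - b^2)], and
    [b r] is self-adjoint. *)
Lemma pos_conj_comm b c : star b = b -> b * c = c * b -> pos c -> pos (b * c * b).
Proof.
move=> sb bc pc; apply: pos_closed => e e0.
pose n := cnorm (b * b) + 1; have n0 : 0 < n by rewrite ltr_wpDl ?cnorm_ge0.
have [r [sr rE rC]] := pos_sqrt pc (divr_gt0 e0 n0).
have br := rC _ bc.
have -> : b * c * b + cst e = (b * r) * (b * r) + cst (e / n) * (cst n - b * b).
  rewrite {2}br mulrA -(mulrA b r) rE mulrDr mulrDl.
  rewrite mulrBr cstM divfK ?lt0r_neq0 // -(cstC _ b) -(mulrA (cst _)) -addrA.
  by rewrite subrKC.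
apply: posD; first by apply: pos_sqr; rewrite starM sr sb br.
apply: posZ; first by rewrite divr_ge0 ?ltW.
by apply: pos_bound; rewrite ?starM ?sb // lerDl.
Qed.

Lemma pos_exp c n : pos c -> pos (c ^+ n).
Proof.
move=> pc; have sc k : star (c ^+ k) = c ^+ k by rewrite starX (pos_star pc).
have cC k : c ^+ k * c = c * c ^+ k by rewrite -exprS exprSr.
rewrite -(odd_double_half n) -addnn addnA; case: (odd n).
  by rewrite add1n exprD exprSr; apply: pos_conj_comm.
by rewrite add0n exprD; apply: pos_sqr.
Qed.

Lemma cnorm_mono x y : pos x -> pos (y - x) -> cnorm x <= cnorm y.
Proof.
move=> px pxy; have sx := pos_star px.
have sy : star y = y by rewrite -[y](subrK x) starD sx (pos_star pxy).
apply: cnorm_le_of_pos => //; first exact: cnorm_ge0.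
  by rewrite -(subrKA y); apply: posD => //; apply: pos_bound.
by apply: posD => //; apply: pos_cst; exact: cnorm_ge0.
Qed.

Lemma cnormX_le x n : cnorm (x ^+ n) <= cnorm x ^+ n.
Proof.
elim: n => [|n IH]; first by rewrite cnorm1.
by rewrite !exprS (le_trans (cnormM _ _)) // ler_wpM2l ?cnorm_ge0.
Qed.

(** The C*-identity gives the exponents [2^k]; for [n <= 2^k], split [x^(2^k) = x^n x^(2^k - n)] and
    use submultiplicativity. *)
Lemma cnormX x n : star x = x -> cnorm (x ^+ n) = cnorm x ^+ n.
Proof.
move=> sx; apply/eqP; rewrite eq_le cnormX_le /=.
have p2 k : cnorm (x ^+ (2 ^ k)) = cnorm x ^+ (2 ^ k).
  elim: k => [|k IH]; first by rewrite !expr1.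
  by rewrite expnSr !exprM -IH -cnorm_starM starX sx -expr2.
have [x0|x0] := eqVneq (cnorm x) 0.
  rewrite x0; case: n => [|n]; last by rewrite expr0n cnorm_ge0.
  by rewrite cnorm1.
have [k nk] : exists k, (n <= 2 ^ k)%N by exists n; rewrite ltnW // ltn_expl.
have xp : 0 < cnorm x by rewrite lt_def x0 cnorm_ge0.
rewrite -(ler_pM2r (exprn_gt0 (2 ^ k - n) xp)) -exprD subnKC // -p2.
rewrite -{1}(subnKC nk) exprD (le_trans (cnormM _ _)) //.
by rewrite ler_wpM2l ?cnorm_ge0 ?cnormX_le.
Qed.
End Positive.

(** * Positivity of [y^* y] in a C*-algebra *)

Section KelleyVaught.
Variables (R : realType) (A : cstarAlgType R).
Implicit Types (x y z h s c d : A) (t e : R).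

(* The operator form of [(n + 1) (1 - t) t^n <= 1] for [t >= 0]. *)
Lemma pos_bernstein c n : pos c -> pos (1 - cst A n.+1%:R * ((1 - c) * c ^+ n)).
Proof.
move=> pc; have sc := pos_star pc.
have s1c : star (1 - c) = 1 - c by rewrite raddfB /= star1 sc.
have cC k : (1 - c) * c ^+ k = c ^+ k * (1 - c).
  by rewrite mulrBl mulrBr mul1r mulr1 -exprS exprSr.
(* Telescoping turns the product into a sum of terms [(1 - c) c^i (1 - c)]. *)
have step j k : pos ((1 - c) * (c ^+ j - c ^+ (j + k))).
  elim: k => [|k IH]; first by rewrite addn0 subrr mulr0; exact: pos0.
  rewrite -(subrKA (c ^+ (j + k)) (c ^+ j)) mulrDr; apply: posD => //.
  have -> : c ^+ (j + k) - c ^+ (j + k.+1) = c ^+ (j + k) * (1 - c).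
    by rewrite addnS exprSr mulrBr mulr1.
  by rewrite mulrA; apply: pos_conj_comm => //; exact: pos_exp.
(* From the geometric sum [1 - c^(n+1) = \sum_(j <= n) (1 - c) c^j], take [(1 - c) c^n] away from
   each of the [n + 1] terms. *)
have -> : 1 - cst A n.+1%:R * ((1 - c) * c ^+ n) =
    c ^+ n.+1 + \sum_(j < n.+1) (1 - c) * (c ^+ j - c ^+ n).
  under eq_bigr do rewrite mulrBr.
  rewrite sumrB sumr_const card_ord -mulr_sumr rmorph_nat mulr_natl addrA.
  congr (_ - _); have := subrX1 c n.+1; rewrite -opprB => /(canRL (@opprK _)).
  by rewrite -mulNr opprB => <-; rewrite subrKC.
apply: posD; first exact: pos_exp.
apply: pos_sum => j _; have := step j (n - j)%N.
by rewrite subnKC // -ltnS.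
Qed.

(* Writing [z = a + i b], this is [2 (a^2 + b^2)]. *)
Lemma pos_sum_star_mul z : pos (star z * z + z * star z).
Proof.
pose a := z + star z; pose b := ('i%C : R[i]) *: (z - star z).
have sa : star a = a by rewrite starD starK addrC.
have sb : star b = b.
  rewrite starZ raddfB /= starK -opprB scalerN -scaleNr; congr (_ *: _).
  by apply/eqP; rewrite eq_complex /= !oppr0 opprK !eqxx.
suff -> : star z * z + z * star z = cst A 2^-1 * (a * a + b * b).
  by apply: posZ; rewrite ?invr_ge0 //; apply: posD; apply: pos_sqr.
have -> : a * a + b * b = cst A 2 * (star z * z + z * star z).
  rewrite /b -scalerAl -scalerAr scalerA -(expr2 'i%C) sqr_i scaleN1r.
  rewrite /a rmorph_nat mulr_natl mulr2n !mulrBl !mulrBr !mulrDl !mulrDr.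
  set zz := z * z; set ss := star z * star z; set u := star z * z; set v := z * star z.
  rewrite !opprB (addrC zz) (addrC (u - ss)) addrACA (addrACA v) (addrACA u).
  by rewrite !subrr !addr0 addrACA (addrC v).
by rewrite mulrA cstM mulVf ?pnatr_eq0 // rmorph1 mul1r.
Qed.

(** If [g > 1], then [g^(n+1) - g^n >= g - 1] for every [n], while [1 / (n + 1)] tends to 0. *)
Lemma exp_gap_le1 (g : R) : 0 <= g ->
  (forall k, g ^+ (k + k).+1 <= (k + k).+1%:R^-1 + g ^+ (k + k)) -> g <= 1.
Proof.
move=> g0 h; rewrite leNgt; apply/negP => g1.
have gp : 0 < g - 1 by rewrite subr_gt0.
have gi : 0 <= (g - 1)^-1 by rewrite invr_ge0 ltW.
set k := Num.Def.archi_bound (g - 1)^-1; have hk : (g - 1)^-1 < k%:R := archi_boundP gi.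
have := h k; rewrite exprS => hg.
have gk : 1 <= g ^+ (k + k) by rewrite exprn_ege1 // ltW.
have : (k + k).+1%:R^-1 < g - 1.
  rewrite -[ltRHS]invrK ltf_pV2 ?posrE ?invr_gt0 //.
  by apply: lt_le_trans hk _; rewrite ler_nat -addnS leq_addr.
have := ler_wpM2l (ltW gp) gk; move: hg.
move: (g ^+ _) (_^-1) => X Y; lra.
Qed.

(* Put [c = 1 - y^* y / M] and [d = 1 - y y^* / M], so that [y c = d y].  For
   [z = y c^k] and [n = 2 k], [z^* z = M (1 - c) c^n <= M / (n + 1)], so
   [z^* z + z z^* >= 0] gives [d^(n + 1) <= d^n + 1 / (n + 1)]; taking norms for
   all [k] forces [|d| <= 1]. *)
Lemma pos_mul_star y : pos (y * star y).
Proof.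
set q := y * star y; set p := star y * y.
have sq : star q = q by rewrite starM starK.
have sp : star p = p by rewrite starM starK.
pose M := cnorm p + cnorm q + 1.
have M0 : 0 < M by rewrite ltr_wpDl ?addr_ge0 ?cnorm_ge0.
pose c := 1 - cst A M^-1 * p; pose d := 1 - cst A M^-1 * q.
have shrink x : star x = x -> cnorm x <= M -> pos (1 - cst A M^-1 * x).
  move=> sx xM; rewrite -(rmorph1 (cst A)); apply: pos_bound.
    by rewrite starM star_cst sx cstC.
  by rewrite cnorm_cstM gtr0_norm ?invr_gt0 // mulrC ler_pdivrMr // mul1r.
have pc : pos c.
  by apply: shrink => //; rewrite /M -addrA lerDl addr_ge0 ?cnorm_ge0.
have pd : pos d.
  by apply: shrink => //; rewrite /M addrAC lerDr addr_ge0 ?cnorm_ge0.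
have McK x : cst A M * (1 - (1 - cst A M^-1 * x)) = x.
  by rewrite subKr mulrA cstM divff ?lt0r_neq0 // rmorph1 mul1r.
have yc n : y * c ^+ n = d ^+ n * y.
  elim: n => [|n IH]; first by rewrite mulr1 mul1r.
  rewrite exprSr mulrA IH exprSr -!mulrA; congr (_ * _).
  by rewrite mulrBr mulrBl mulr1 mul1r mulrA -cstC -!mulrA.
have pC n : p * c ^+ n = c ^+ n * p.
  by apply: commrX; rewrite /GRing.comm mulrBr mulrBl mulr1 mul1r mulrA -cstC mulrA.
suff d1 : cnorm d <= 1.
  split=> //; exists M; have -> : cst A M - q = cst A M * d.
    by rewrite -{1}(McK q) -/d mulrBr mulr1 subKr.
  by rewrite cnorm_cstM gtr0_norm // -[leRHS]mulr1 ler_pM2l.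
apply: exp_gap_le1 => [|k]; first exact: cnorm_ge0.
set n := (k + k)%N; pose z := y * c ^+ k.
have zz : star z * z = cst A M * ((1 - c) * c ^+ n).
  rewrite /z starM starX (pos_star pc) mulrA -(mulrA _ (star y)) -/p -pC -mulrA -exprD.
  by rewrite mulrA McK.
have zz' : z * star z = cst A M * (d ^+ n * (1 - d)).
  rewrite /z starM starX (pos_star pc) mulrA -(mulrA y) -exprD yc -mulrA -/q.
  by rewrite -{1}(McK q) mulrA -cstC -mulrA.
have h1 : pos ((1 - c) * c ^+ n + d ^+ n * (1 - d)).
  have : pos (cst A M^-1 * (star z * z + z * star z)).
    by apply: posZ; [rewrite invr_ge0 ltW | exact: pos_sum_star_mul].
  by rewrite zz zz' -mulrDr mulrA cstM mulVf ?lt0r_neq0 // rmorph1 mul1r.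
have h2 : pos (cst A n.+1%:R^-1 - (1 - c) * c ^+ n).
  have : pos (cst A n.+1%:R^-1 * (1 - cst A n.+1%:R * ((1 - c) * c ^+ n))).
    by apply: posZ; [rewrite invr_ge0 | apply: pos_bernstein].
  by rewrite mulrBr mulr1 mulrA cstM mulVf ?pnatr_eq0 // rmorph1 mul1r.
have h3 : pos (cst A n.+1%:R^-1 + d ^+ n - d ^+ n.+1).
  by have := posD h2 h1; rewrite addrA subrK mulrBr mulr1 -exprSr addrA.
have := cnorm_mono (pos_exp n.+1 pd) h3.
rewrite !cnormX ?(pos_star pd) // => /le_trans; apply.
apply: le_trans (cnormD _ _) _.
by rewrite cnormX ?(pos_star pd) // cnorm_cst // invr_ge0.
Qed.

Lemma pos_star_mul y : pos (star y * y).
Proof. by have := pos_mul_star (star y); rewrite starK. Qed.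

Lemma pos_inv h : pos h -> exists g, (1 + h) * g = 1 /\ g * (1 + h) = 1.
Proof.
move=> ph; have [sh [t ht]] := ph.
have t0 : 0 <= t by exact: le_trans (cnorm_ge0 _) ht.
have t1 : 0 < t + 1 by lra.
have E : 1 + h = cst A (t + 1) * (1 - cst A (t + 1)^-1 * (cst A t - h)).
  rewrite mulrBr mulr1 mulrA cstM divff ?lt0r_neq0 // rmorph1 mul1r.
  by rewrite rmorphD /= rmorph1 opprB (addrC (cst A t)) -addrA subrKC.
have [|g [g1 g2]] := @one_sub_inv _ _ (cst A (t + 1)^-1 * (cst A t - h)).
  rewrite cnorm_cstM ger0_norm ?invr_ge0 ?ltW // mulrC ltr_pdivrMr //; lra.
exists (cst A (t + 1)^-1 * g); rewrite E; split.
  rewrite mulrA -(mulrA (cst A _)) -cstC mulrA cstM divff ?lt0r_neq0 // rmorph1.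
  by rewrite mul1r.
rewrite mulrA -(mulrA (cst A _) g) -cstC mulrA cstM mulVf ?lt0r_neq0 // rmorph1.
by rewrite mul1r.
Qed.
End KelleyVaught.

(** * Sums of hermitian squares of matrices *)

Section StarMatrix.
Variables (R : realType) (A : cstarAlgType R).
Local Notation cst := (@cst R A).
Implicit Types (t e : R).

Definition adjmx m n (Y : 'M[A]_(m, n)) : 'M[A]_(n, m) := (map_mx (@star R A) Y)^T.

Lemma adjmxE m n (Y : 'M[A]_(m, n)) i j : adjmx Y i j = star (Y j i).
Proof. by rewrite !mxE. Qed.

Lemma adjmx_is_zmod_morphism m n : zmod_morphism (@adjmx m n).
Proof. by move=> X Y; apply/matrixP => i j; rewrite !mxE raddfB. Qed.

HB.instance Definition _ m n := GRing.isZmodMorphism.Build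
  'M[A]_(m, n) 'M[A]_(n, m) (@adjmx m n) (@adjmx_is_zmod_morphism m n).

Lemma adjmxK m n (X : 'M[A]_(m, n)) : adjmx (adjmx X) = X.
Proof. by apply/matrixP => i j; rewrite !mxE starK. Qed.

Lemma adjmxM m n p (X : 'M[A]_(m, n)) (Y : 'M[A]_(n, p)) :
  adjmx (X *m Y) = adjmx Y *m adjmx X.
Proof.
apply/matrixP => i j; rewrite !mxE raddf_sum; apply: eq_bigr => k _.
by rewrite !mxE /= starM.
Qed.

Lemma adj_scalar_mx n (a : A) : adjmx (a%:M : 'M_n) = (star a)%:M.
Proof. by apply/matrixP => i j; rewrite !mxE raddfMn eq_sym. Qed.

Lemma adj_col_mx m1 m2 n (X : 'M[A]_(m1, n)) (Y : 'M[A]_(m2, n)) :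
  adjmx (col_mx X Y) = row_mx (adjmx X) (adjmx Y).
Proof. by rewrite /adjmx map_col_mx tr_col_mx. Qed.

Lemma adj_delta_mx m n i j : adjmx (delta_mx i j : 'M_(m, n)) = delta_mx j i.
Proof.
by apply/matrixP => k l; rewrite !mxE andbC; case: (_ && _); rewrite ?star1 ?raddf0.
Qed.

Lemma mulmx_scale_comm m n p (X : 'M[A]_(m, n)) (Y : 'M[A]_(n, p)) (a : A) :
  (forall i j, X i j * a = a * X i j) -> X *m (a *: Y) = a *: (X *m Y).
Proof.
move=> h; apply/matrixP => i j; rewrite !mxE mulr_sumr; apply: eq_bigr => k _.
by rewrite mxE !mulrA h.
Qed.

Lemma mulmx_cst m n p (X : 'M[A]_(m, n)) (Y : 'M[A]_(n, p)) t :
  X *m (cst t *: Y) = cst t *: (X *m Y).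
Proof. by apply: mulmx_scale_comm => i j; rewrite cstC. Qed.

Lemma adj_scale_cst m n (X : 'M[A]_(m, n)) t : adjmx (cst t *: X) = cst t *: adjmx X.
Proof. by apply/matrixP => i j; rewrite !mxE starM star_cst cstC. Qed.

(* Rectangular factors make sums of hermitian squares immediate: [M_n(A)] need
   not be known to be a C*-algebra. *)
Definition sos n (x : 'M[A]_n) : Prop :=
  exists N (Y : 'M[A]_(N, n)), x = adjmx Y *m Y.

Lemma sos_adj n (x : 'M[A]_n) : sos x -> adjmx x = x.
Proof. by case=> N [Y ->]; rewrite adjmxM adjmxK. Qed.

Lemma sos_intro N n (Y : 'M[A]_(N, n)) : sos (adjmx Y *m Y).
Proof. by exists N, Y. Qed.

Lemma adj_mul_col_mx m1 m2 n p (X : 'M[A]_(m1, n)) (Y : 'M[A]_(m2, n))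
    (X' : 'M[A]_(m1, p)) (Y' : 'M[A]_(m2, p)) :
  adjmx (col_mx X Y) *m col_mx X' Y' = adjmx X *m X' + adjmx Y *m Y'.
Proof. by rewrite adj_col_mx mul_row_col. Qed.

Lemma sosD n (x y : 'M[A]_n) : sos x -> sos y -> sos (x + y).
Proof. by move=> [N [X ->]] [M [Y ->]]; rewrite -adj_mul_col_mx; exact: sos_intro. Qed.

Lemma sos0 n : sos (0 : 'M[A]_n).
Proof. by rewrite -(mulmx0 _ (adjmx (0 : 'M[A]_(0, n)))); exact: sos_intro. Qed.

Lemma sosZ n t (x : 'M[A]_n) : 0 <= t -> sos x -> sos (cst t *: x).
Proof.
move=> t0 [N [X ->]]; exists N, (cst (Num.sqrt t) *: X).
rewrite adj_scale_cst mulmx_cst -scalemxAl scalerA cstM -expr2 sqr_sqrtr //.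
Qed.

Lemma sos1 n : sos (1%:M : 'M[A]_n).
Proof. by exists n, 1%:M; rewrite adj_scalar_mx star1 mulmx1. Qed.

Lemma sos_cst n t : 0 <= t -> sos ((cst t)%:M : 'M[A]_n).
Proof.
by move=> t0; rewrite -[cst t]mulr1 -scale_scalar_mx; apply: sosZ => //; exact: sos1.
Qed.

Lemma sos_pos (x : 'M[A]_1) : sos x -> pos (x 0 0).
Proof.
move=> [N [Y ->]]; rewrite mxE; apply: pos_sum => i _.
by rewrite adjmxE; exact: pos_star_mul.
Qed.

Lemma sos_order_unit n (v : 'M[A]_n) :
  exists t, 0 <= t /\ sos ((cst t)%:M - (v + adjmx v)).
Proof.
(* The property passes to sums, so only [a *: delta_mx i j] has to be treated. *)
pose P (w : 'M[A]_n) := exists t, 0 <= t /\ sos ((cst t)%:M - (w + adjmx w)).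
rewrite (matrix_sum_delta v) -/(P _).
have PD w w' : P w -> P w' -> P (w + w').
  move=> [t [t0 h]] [s [s0 h']]; exists (t + s); split; first by rewrite addr_ge0.
  rewrite (raddfD (@adjmx n n)) /= [w + w' + _]addrACA -cstD raddfD /= opprD addrACA.
  exact: sosD.
have P0 : P 0.
  exists 0; split => //; rewrite !raddf0 addr0 subr0; exact: sos0.
apply: big_ind => // i _; apply: big_ind => // j _; move: (v i j) => a.
pose M := cnorm (star a * a).
have M0 : 0 <= M by exact: cnorm_ge0.
have [d [sd dE _]] : exists s, [/\ star s = s, s * s = cst M - star a * a + cst 1
    & forall x, x * (cst M - star a * a) = (cst M - star a * a) * x -> x * s = s * x].
  by apply: pos_sqrt => //; apply: pos_bound; rewrite ?starM ?starK.
have dmC (b : A) (i' j' k l : 'I_n) : delta_mx i' j' k l * b = b * delta_mx i' j' k l.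
  by rewrite mxE; case: (_ && _); rewrite ?mulr1 ?mul1r ?mul0r ?mulr0.
have adE (b : A) (k l : 'I_n) :
    adjmx (b *: delta_mx k l) = star b *: delta_mx l k.
  apply/matrixP => k' l'; rewrite !mxE starM andbC.
  by case: (_ && _); rewrite ?star1 ?raddf0 ?mulr1 ?mul1r ?mulr0 ?mul0r.
have sqE (b : A) : adjmx (b *: delta_mx i j) *m (b *: delta_mx i j) =
    (star b * b) *: (delta_mx j j : 'M[A]_n).
  by rewrite adE -scalemxAl mulmx_scale_comm // mul_delta_mx scalerA.
exists (M + 1 + 1); split; first by rewrite !addr_ge0.
set E := a *: delta_mx i j; set D := d *: delta_mx i j.
set Q : 'M[A]_n := delta_mx j j.
(* The first square leaves the term [a^* a Q]. Since [d^2 = M + 1 - a^* a], the second turns it into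
   [(M + 1) Q], and the third fills the rest of the diagonal. *)
have -> : (cst (M + 1 + 1))%:M - (E + adjmx E) = adjmx (1%:M - E) *m (1%:M - E) +
    (adjmx D *m D + cst (M + 1) *: (adjmx (1%:M - Q) *m (1%:M - Q))).
  rewrite !sqE sd dE !(raddfB (@adjmx n n)) /= adj_scalar_mx star1 adj_delta_mx.
  rewrite !mulmxBl !mulmxBr !mulmx1 !mul1mx sqE mul_delta_mx subrr subr0 scalerBr.
  have dsE : cst M - star a * a + cst 1 = cst (M + 1) - star a * a by rewrite addrAC cstD.
  rewrite dsE scalerBl scale_scalar_mx mulr1 addrC opprB.
  rewrite [_ *: Q - _ + _]addrC subrKA.
  rewrite -[RHS]addrA (addrC (_ - adjmx E)) subrKA addrACA -opprD addrC.
  by congr (_ - _); rewrite -raddfD -(rmorph1 cst) cstD [1 + _]addrC.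
do 2![apply: sosD; first exact: sos_intro].
by apply: sosZ; [rewrite addr_ge0 | exact: sos_intro].
Qed.

(* Induction on the number of rows of the factor: adding a row [y] is a rank one
   update of the inverse (Sherman-Morrison), which needs only the invertibility
   in [A] of [1 + y g y^*]. *)
Lemma sos_add_cst_inv n (x : 'M[A]_n) e : 0 < e -> sos x ->
  exists g, [/\ (x + (cst e)%:M) *m g = 1%:M, g *m (x + (cst e)%:M) = 1%:M & adjmx g = g].
Proof.
move=> e0 [N [Y ->]].
suff [g [g1 _]] : exists g, (adjmx Y *m Y + (cst e)%:M) *m g = 1%:M /\ sos g.
  have sc : adjmx (adjmx Y *m Y + (cst e)%:M) = adjmx Y *m Y + (cst e)%:M.
    by rewrite raddfD /= adjmxM adjmxK adj_scalar_mx star_cst.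
  have g2 : adjmx g *m (adjmx Y *m Y + (cst e)%:M) = 1%:M.
    by rewrite -{1}sc -adjmxM g1 adj_scalar_mx star1.
  have gg : adjmx g = g by rewrite -[LHS]mulmx1 -g1 mulmxA g2 mul1mx.
  by exists g; rewrite -{2}gg.
elim: N Y => [|N IH] Y.
  exists (cst e^-1)%:M; split; last by apply: sos_cst; rewrite invr_ge0 ltW.
  rewrite (flatmx0 Y) mulmx0 add0r -scalar_mxM cstM divff ?lt0r_neq0 // rmorph1 //.
have [y [Y' ->]] : exists (y : 'rV_n) (Y' : 'M_(N, n)),
    adjmx Y *m Y = adjmx y *m y + adjmx Y' *m Y'.
  exists (usubmx (Y : 'M_(1 + N, n))), (dsubmx (Y : 'M_(1 + N, n))).
  by rewrite -adj_mul_col_mx vsubmxK.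
have [g0 [g1 gs]] := IH Y'; set c0 := adjmx Y' *m Y' + _ in g1.
have [Z gZ] : exists M (Z : 'M[A]_(M, n)), g0 = adjmx Z *m Z by [].
have [k [k1 _]] : exists k, (1 + (y *m g0 *m adjmx y) 0 0) * k = 1 /\
    k * (1 + (y *m g0 *m adjmx y) 0 0) = 1.
  apply/pos_inv/sos_pos; case: gZ => Z' ->.
  by exists Z, (Z' *m adjmx y); rewrite adjmxM adjmxK !mulmxA.
have kM : (1%:M + y *m g0 *m adjmx y) *m k%:M = 1%:M :> 'M_1.
  by rewrite [y *m g0 *m adjmx y]mx11_scalar -raddfD /= -scalar_mxM k1.
pose g := g0 - g0 *m adjmx y *m k%:M *m y *m g0.
have cg : (adjmx y *m y + adjmx Y' *m Y' + (cst e)%:M) *m g = 1%:M.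
  pose B := adjmx y *m k%:M *m y *m g0.
  have -> : g = g0 - g0 *m B by rewrite /g /B !mulmxA.
  have yB : y *m (g0 *m B) = y *m g0 - k%:M *m (y *m g0).
    have := kM; rewrite mulmxDl mul1mx => /(canRL (addKr _)) hk.
    by rewrite /B !mulmxA hk !mulmxDl !mulNmx mul1mx addrC.
  rewrite -addrA -/c0 mulmxDl (mulmxBr c0) (mulmxA c0) g1 mul1mx -mulmxA.
  rewrite (mulmxBr y) yB subKr.
  by rewrite /B !mulmxA subrKC.
clearbody g; exists g; split => //; move: cg; set c := _ + (cst e)%:M => cg.
have sc : adjmx c = c.
  by rewrite !raddfD /= !adjmxM !adjmxK adj_scalar_mx star_cst.
have g2 : adjmx g *m c = 1%:M by rewrite -{1}sc -adjmxM cg adj_scalar_mx star1.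
have gg : adjmx g = g by rewrite -[LHS]mulmx1 -cg mulmxA g2 mul1mx.
(* Positivity of the new inverse: [g^* c g] splits along the three summands of [c]. *)
have -> : g = adjmx g *m c *m g by rewrite g2 mul1mx.
rewrite /c !mulmxDr !mulmxDl.
apply: sosD; first apply: sosD.
- by exists 1, (y *m g); rewrite adjmxM !mulmxA.
- by exists N, (Y' *m g); rewrite adjmxM !mulmxA.
- rewrite -[cst e]mulr1 -scale_scalar_mx mulmx_cst mulmx1 -scalemxAl.
  by apply: sosZ; [exact: ltW | exact: sos_intro].
Qed.
End StarMatrix.

(** * Parallel sums, and chains of columns with prescribed Gram entries *)

Section Chain.
Variables (R : realType) (A : cstarAlgType R).
Local Notation cst := (@cst R A).

(* With [w = a1 g a2 = a2 g a1] (the parallel sum), the difference is [4 w], and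
   [w = a1 g (a1 + a2) g a2] splits into two hermitian squares. *)
Lemma sos_parallel r (a1 a2 g : 'M[A]_r) : sos a1 -> sos a2 ->
  (a1 + a2) *m g = 1%:M -> g *m (a1 + a2) = 1%:M -> adjmx g = g ->
  sos (a1 + a2 - (a1 - a2) *m g *m (a1 - a2)).
Proof.
move=> s1 s2 cg gc sg; have ad1 := sos_adj s1; have ad2 := sos_adj s2.
set c := a1 + a2 in cg gc *.
have a2E : a2 = c - a1 by rewrite /c addrC addKr.
have w12 : a1 *m g *m a2 = a1 - a1 *m g *m a1.
  by rewrite a2E mulmxBr -(mulmxA a1 g c) gc mulmx1.
have w21 : a2 *m g *m a1 = a1 - a1 *m g *m a1.
  by rewrite a2E !mulmxBl cg mul1mx.
have -> : c - (a1 - a2) *m g *m (a1 - a2) = cst 4%:R *: (a1 *m g *m a2).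
  have a22 : a2 *m g *m a2 = a2 - (a1 - a1 *m g *m a1).
    by rewrite {2}a2E mulmxBr -(mulmxA a2 g c) gc mulmx1 w21.
  rewrite !mulmxBl !mulmxBr w12 w21 a22; set p := a1 *m g *m a1; set q := a1 - p.
  have a1E : a1 = q + p by rewrite subrK.
  rewrite rmorph_nat scaler_nat /c {1}a1E !opprB (addrC (q + p)).

  rewrite addrACA (addrCA a2) subrKC (addrACA q p) subrr addr0.
  by rewrite -!mulr2n -mulrnA.
have -> : a1 *m g *m a2 = a1 *m g *m a2 *m g *m a1 + a2 *m g *m a1 *m g *m a2.
  transitivity (a1 *m g *m c *m g *m a2); first by rewrite -(mulmxA a1 g c) gc mulmx1.
  have cm : a1 *m g *m a2 = a2 *m g *m a1 by rewrite w12 w21.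
  rewrite {1}/c mulmxDr !mulmxDl [in X in _ + X]cm; congr (_ + _).
  by rewrite -(mulmxA (a1 *m g) a1 g) -(mulmxA (a1 *m g) (a1 *m g)) [in LHS]cm !mulmxA.
have sos_sandwich (a b : 'M[A]_r) : sos a -> adjmx b = b -> sos (b *m g *m a *m g *m b).
  move=> [N [Y ->]] sb; exists N, (Y *m g *m b).
  by rewrite !adjmxM sg sb !mulmxA.
by apply: sosZ => //; apply: sosD; apply: sos_sandwich.
Qed.

(* [b_(j+1) = b_j g w (+) d] with [d^* d = c - w g w], where [w] is [u] or [v]. *)
Lemma isometric_chain r (c g u v : 'M[A]_r) n :
  c *m g = 1%:M -> g *m c = 1%:M -> adjmx g = g -> adjmx u = u -> adjmx v = v ->
  sos c -> sos (c - u *m g *m u) -> sos (c - v *m g *m v) ->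
  exists N (b : nat -> 'M[A]_(N, r)),
    (forall j, (j <= n)%N -> adjmx (b j) *m b j = c) /\
    (forall j, (j < n)%N -> adjmx (b j) *m b j.+1 = if odd j then v else u).
Proof.
move=> cg gc sg su sv sc hu hv; elim: n => [|n [N [b [b1 b2]]]].
  by case: sc => N [Y ->]; exists N, (fun=> Y).
set w := if odd n then v else u; have sw : adjmx w = w by rewrite /w; case: odd.
have [D [d dE]] : sos (c - w *m g *m w) by rewrite /w; case: odd.
exists (N + D)%N, (fun j => if (j <= n)%N then col_mx (b j) 0 else col_mx (b n *m g *m w) d).
split=> j; rewrite leq_eqVlt => /orP[/eqP jn|jn].
- rewrite jn ltnn adj_mul_col_mx -dE !adjmxM sg sw !mulmxA.
  by rewrite -(mulmxA (w *m g)) b1 // -(mulmxA w) gc mulmx1 subrKC.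
- by rewrite ltnS in jn; rewrite jn adj_mul_col_mx mulmx0 addr0 b1.
- case: jn => ->; rewrite leqnn ltnn adj_mul_col_mx raddf0 mul0mx addr0.
  by rewrite !mulmxA b1 // cg mul1mx.
- rewrite ltnS in jn; rewrite (ltnW jn) jn adj_mul_col_mx mulmx0 addr0.
  exact: b2.
Qed.
End Chain.

(** * Separation of wedges by positive functionals *)

Section PositiveFunctional.
Local Open Scope classical_set_scope.
(* The scalar ring [K] only receives the reals: square matrices over a C*-algebra
   [A] form an [A]-module here, and no [R]-module. *)
Variables (R : realType) (K : nzRingType) (iota : {rmorphism R -> K}) (V : lmodType K).
Local Notation "t *' v" := (iota t *: v) (at level 40).

Definition wedge (P : set V) :=
  (forall x y, P x -> P y -> P (x + y)) /\ (forall t x, 0 <= t -> P x -> P (t *' x)).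

Variable e : V.

Lemma wedge_negmul (P : set V) t : wedge P -> ~ P (- e) -> t < 0 -> ~ P (t *' e).
Proof.
move=> [_ PZ] Pe t0 Pt; apply: Pe; have := PZ (- t)^-1 _ _ Pt.
rewrite scalerA -rmorphM invrN mulNr mulVf ?lt_eqF // rmorphN1 scaleN1r; apply.
by rewrite -invrN invr_ge0 oppr_ge0 ltW.
Qed.

Lemma maximal_wedge (W : set V) : wedge W -> ~ W (- e) ->
  exists P : set V, [/\ W `<=` P, wedge P, ~ P (- e)
    & forall Q : set V, P `<=` Q -> wedge Q -> ~ Q (- e) -> Q `<=` P].
Proof.
move=> [WD WZ] We; pose good (X : set V) := wedge X /\ ~ X (- e).
(* [Zorn_bigcup] also asks about the empty chain, hence the union with [W]. *)
have [|A [[[AD AZ] Ae] Amax]] := @Zorn_bigcup _ (fun X => good (X `|` W)).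
  move=> F FP Ftot.
  have D X x y : F X -> X x \/ W x -> X y \/ W y -> (\bigcup_(X in F) X `|` W) (x + y).
    by move=> FX hx hy; have [[XD _] _] := FP _ FX; have [|] := XD x y hx hy;
      [left; exists X | right].
  split; [split|].
  - move=> x y [[X FX Xx]|Wx] [[Y FY Yy]|Wy].
    + have [XY|YX] := Ftot _ _ FX FY.
        by apply: (D Y) => //; left => //; exact: XY.
      by apply: (D X) => //; left => //; exact: YX.
    + by apply: (D X) => //; [left | right].
    + by apply: (D Y) => //; [right | left].
    + by right; exact: WD.
  - move=> t x t0 [[X FX Xx]|Wx]; last by right; exact: WZ.
    have [[_ Z] _] := FP _ FX.
    by have [|] := Z t x t0 (or_introl Xx); [left; exists X | right].
  - by case=> // -[X FX Xe]; case: (FP _ FX) => _; apply; left.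
exists (A `|` W); split; [by move=> x Wx; right | by [] | by [] | move=> Q AQ Qw Qe x Qx].
apply: contrapT => nx; apply: (Amax Q).
  split; first by move=> y Ay; apply: AQ; left.
  by move=> /(_ x Qx) Ax; apply: nx; left.
have -> : Q `|` W = Q by apply/setUidl => y Wy; apply: AQ; right.
by [].
Qed.

(** If [P] contained neither [v] nor [- v], maximality would give [- e = p + t v] and
    [- e = q - s v] with [s, t > 0]; eliminating [v] puts [- (s + t) e] in [P]. *)
Lemma maximal_wedge_total (P : set V) : P 0 -> wedge P -> ~ P (- e) ->
  (forall Q : set V, P `<=` Q -> wedge Q -> ~ Q (- e) -> Q `<=` P) ->
  forall v, P v \/ P (- v).
Proof.
move=> P0 [PD PZ] Pe Pmax v.
have out w : ~ P w -> exists p t, [/\ P p, 0 < t & - e = p + t *' w].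
  move=> Pw; pose Q x := exists p t, [/\ P p, 0 <= t & x = p + t *' w].
  have PQ : P `<=` Q by move=> x Px; exists x, 0; rewrite rmorph0 scale0r addr0.
  have [[p [t [Pp t0 E]]]|Qe] := pselect (Q (- e)).
    exists p, t; split => //; rewrite lt_def t0 andbT; apply/eqP => t0'.
    by apply: Pe; rewrite E t0' rmorph0 scale0r addr0.
  case: Pw; apply: (Pmax Q) => //; last first.
    by exists 0, 1; rewrite rmorph1 scale1r add0r.
  split=> [x y [p [t [Pp t0 ->]]] [q [s [Pq s0 ->]]]|s x s0 [p [t [Pp t0 ->]]]].
    by exists (p + q), (t + s); rewrite rmorphD scalerDl addrACA addr_ge0 //; split=> //; exact: PD.
  by exists (s *' p), (s * t); rewrite rmorphM scalerDr scalerA mulr_ge0 //; split=> //; exact: PZ.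
apply: contrapT => /not_orP[/out[p [t [Pp t0 E1]]] /out[q [s [Pq s0 E2]]]].
apply: (wedge_negmul (conj PD PZ) Pe (_ : - (s + t) < 0)); first by rewrite oppr_lt0 addr_gt0.
have -> : - (s + t) *' e = s *' p + t *' q.
  rewrite rmorphN scaleNr -scalerN rmorphD scalerDl {1}E1 E2 !scalerDr !scalerN !scalerA.
  by rewrite -!rmorphM (mulrC t) addrACA subrr addr0.
by apply: PD; apply: PZ => //; exact: ltW.
Qed.

Lemma total_wedge_functional (P : set V) : P e -> wedge P -> ~ P (- e) ->
  (forall v, P v \/ P (- v)) -> (forall v, exists t, P (t *' e - v)) ->
  exists f : V -> R, [/\ forall v w, f (v + w) = f v + f w,
    forall t v, f (t *' v) = t * f v, forall v, P v -> 0 <= f v & f e = 1].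
Proof.
move=> Pe0 Pw Pe tot unit; have [PD PZ] := Pw.
(* The value of [f] at [v] is the cut that [v] makes on the line of multiples of [e]. The margin [d]
   avoids any closedness of [P], and each law of [f] becomes an instance of uniqueness. *)
pose near v x := forall d, 0 < d -> P (v - (x - d) *' e) /\ P ((x + d) *' e - v).
have near_uniq v x y : near v x -> near v y -> x = y.
  suff le a b : near v a -> near v b -> a <= b.
    by move=> h1 h2; apply/eqP; rewrite eq_le !le.
  move=> ha hb; rewrite leNgt; apply/negP => ab.
  have d0 : 0 < (a - b) / 3 by rewrite divr_gt0 // subr_gt0.
  have [h _] := ha _ d0; have [_ h'] := hb _ d0.
  have := PD _ _ h' h; rewrite subrKA -scalerBl -rmorphB.
  apply: wedge_negmul => //; lra.
have near_ex v : exists x, near v x.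
  pose E : set R := fun t => P (v - t *' e).
  have [t0 h0] := unit (- v); have [t1 h1] := unit v.
  have E0 : E (- t0) by rewrite /E rmorphN scaleNr opprK addrC -[v]opprK.
  have ub s t : P (t *' e - v) -> E s -> s <= t.
    move=> h Es; rewrite leNgt; apply/negP => ts.
    have := PD _ _ h Es; rewrite subrKA -scalerBl -rmorphB.
    by apply: wedge_negmul => //; rewrite subr_lt0.
  have supE : has_sup E by split; [exists (- t0) | exists t1 => s; exact: ub].
  exists (sup E) => d d0; split.
    have [s Es /ltW hs] := sup_adherent d0 supE.
    have -> : v - (sup E - d) *' e = (v - s *' e) + (s - (sup E - d)) *' e.
      by rewrite (rmorphB _ s) scalerBl addrA subrK.
    by apply: PD => //; apply: PZ => //; rewrite subr_ge0.
  case: (tot ((sup E + d) *' e - v)) => //; rewrite opprB => h.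
  have := sup_upper_bound supE h; lra.
have [f hf] := choice near_ex; exists f; split.
- move=> v w; apply: near_uniq (hf _) _ => d d0.
  have d2 : 0 < d / 2 by rewrite divr_gt0.
  have [v1 v2] := hf v _ d2; have [w1 w2] := hf w _ d2; split.
    have := PD _ _ v1 w1; rewrite addrACA -opprD -scalerDl -rmorphD.
    by congr (P (_ - iota _ *: _)); lra.
  have := PD _ _ v2 w2; rewrite addrACA -opprD -scalerDl -rmorphD.
  by congr (P (iota _ *: _ - _)); lra.
- have pos t v : 0 < t -> f (t *' v) = t * f v.
    move=> t0; apply: near_uniq (hf _) _ => d d0.
    have [v1 v2] := hf v _ (divr_gt0 d0 t0); split.
      have := PZ t _ (ltW t0) v1; rewrite scalerBr scalerA -rmorphM.
      by congr (P (_ - iota _ *: _)); field; rewrite gt_eqF.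
    have := PZ t _ (ltW t0) v2; rewrite scalerBr scalerA -rmorphM.
    by congr (P (iota _ *: _ - _)); field; rewrite gt_eqF.
  have opp v : f (- v) = - f v.
    apply: near_uniq (hf _) _ => d d0; have [v1 v2] := hf v _ d0.
    split; first by rewrite -[- f v - d]opprD rmorphN scaleNr opprK addrC.
    by rewrite opprK addrC [- f v + d]addrC -opprB rmorphN scaleNr.
  move=> t v; have [t0|t0|->] := ltgtP t 0; last 1 first.
  + rewrite rmorph0 scale0r mul0r; apply: near_uniq (hf _) _ => d d0.
    by rewrite !sub0r add0r subr0 rmorphN scaleNr opprK; split; apply: PZ => //; exact: ltW.
  + have := pos (- t) v; rewrite oppr_gt0 => /(_ t0).
    by rewrite rmorphN scaleNr opp mulNr => /oppr_inj.
  + exact: pos.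
- move=> v Pv; rewrite leNgt; apply/negP => fv.
  have d0 : 0 < - f v / 2 by rewrite divr_gt0 // oppr_gt0.
  have [_ h] := hf v _ d0; have := PD _ _ h Pv; rewrite subrK.
  apply: wedge_negmul => //; lra.
- apply: near_uniq (hf _) _ => d d0.
  have Pd : P (d *' e) by apply: PZ => //; exact: ltW.
  split; first by rewrite rmorphB rmorph1 scalerBl scale1r subKr.
  by rewrite rmorphD rmorph1 scalerDl scale1r addrAC subrr add0r.
Qed.

(** Extend the wedge [W] of all [c - t z], with [c] in [C] and [t >= 0]. It omits [- e]: for
    [t > 0], [- e = c - t z] would put [z = t^-1 (c + e)] in [C], and for [t = 0] the order unit
    would put [z] in [C]. The bound on [f z] comes from [- z] in [W]. *)
Lemma positive_functional (C : set V) (z : V) : wedge C -> C e ->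
  (forall v, exists t, C (t *' e - v)) -> ~ C z ->
  exists f : V -> R, [/\ forall v w, f (v + w) = f v + f w,
    forall t v, f (t *' v) = t * f v, forall v, C v -> 0 <= f v, f e = 1 & f z <= 0].
Proof.
move=> Cw Ce unit Cz; have [CD CZ] := Cw.
have C0 : C 0 by rewrite -(scale0r e) -(rmorph0 iota); exact: CZ.
pose W x := exists c t, [/\ C c, 0 <= t & x = c - t *' z].
have CW : C `<=` W by move=> c Cc; exists c, 0; rewrite rmorph0 scale0r subr0.
have Ww : wedge W.
  split=> [x y [c [t [Cc t0 ->]]] [d [s [Cd s0 ->]]]|s x s0 [c [t [Cc t0 ->]]]].
    exists (c + d), (t + s); rewrite rmorphD scalerDl opprD addrACA addr_ge0 //.
    by split=> //; exact: CD.
  exists (s *' c), (s * t); rewrite rmorphM scalerBr scalerA mulr_ge0 //.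
  by split=> //; exact: CZ.
have We : ~ W (- e).
  move=> [c [t [Cc t0 E]]]; apply: Cz; have [t00|tn0] := eqVneq t 0.
    have Cne : C (- e) by rewrite E t00 rmorph0 scale0r subr0.
    have [s hs] := unit (- z).
    have [s0|s0] := lerP 0 s.
      have := CD _ _ hs (CZ _ _ s0 Cne).
      by rewrite opprK scalerN addrAC subrr add0r.
    have := CD _ _ hs (CZ (- s) e _ Ce); rewrite oppr_ge0 ltW // => /(_ isT).
    by rewrite opprK rmorphN scaleNr addrAC subrr add0r.
  have tp : 0 < t by rewrite lt_def tn0.
  have tz : t *' z = c + e by rewrite -[c](subrK (t *' z)) -E addrAC addNr add0r.
  have -> : z = t^-1 *' (t *' z) by rewrite scalerA -rmorphM mulVf // rmorph1 scale1r.
  by rewrite tz; apply: CZ; [rewrite invr_ge0 | exact: CD].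
have [P [WP Pw Pe Pmax]] := maximal_wedge Ww We.
have CP : C `<=` P by move=> x /CW /WP.
have tot := maximal_wedge_total (CP _ C0) Pw Pe Pmax.
have unitP v : exists t, P (t *' e - v) by have [t /CP] := unit v; exists t.
have [f [f1 f2 f3 f4]] := total_wedge_functional (CP _ Ce) Pw Pe tot unitP.
exists f; split => // [v /CP/f3 //|].
have : 0 <= f (- z).
  by apply/f3/WP; exists 0, 1; rewrite rmorph1 scale1r sub0r.
by have := f2 (-1) z; rewrite rmorphN1 scaleN1r mulN1r => ->; rewrite oppr_ge0.
Qed.
End PositiveFunctional.

(** * From positive functionals to ucp maps *)

Section Factor.
Variable C : numClosedFieldType.

(** Expanding at [l + m] gives [B l m + B m l = 0]; replacing [m] by ['i m] gives
    [B l m = B m l]. *)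
Lemma polarization (V : lmodType C) r (x : 'I_r -> 'I_r -> V) :
  (forall l : 'I_r -> C, \sum_i \sum_j ((l i)^* * l j) *: x i j = 0) ->
  forall i j, x i j = 0.
Proof.
move=> x0; pose B (l m : 'I_r -> C) := \sum_i \sum_j ((l i)^* * m j) *: x i j.
have BD l m : B l m + B m l = 0.
  have := x0 (fun i => l i + m i).
  have -> : \sum_i \sum_j ((l i + m i)^* * (l j + m j)) *: x i j =
      (B l l + B m m) + (B l m + B m l).
    rewrite /B -!big_split; apply: eq_bigr => i _; rewrite -!big_split.
    apply: eq_bigr => j _ /=; rewrite rmorphD !mulrDl !mulrDr !scalerDl.
    by rewrite addrACA [X in _ + _ + X]addrC -!addrA; congr (_ + _); rewrite addrCA.
  by rewrite {1}/B x0 {1}/B x0 addr0 add0r.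
have B0 l m : B l m = 0.
  have h := BD l (fun i => 'i * m i).
  have E1 : B l (fun i => 'i * m i) = 'i *: B l m.
    rewrite /B scaler_sumr; apply: eq_bigr => i _; rewrite scaler_sumr.
    by apply: eq_bigr => j _; rewrite scalerA mulrCA.
  have E2 : B (fun i => 'i * m i) l = - ('i *: B m l).
    rewrite -scaleNr /B scaler_sumr; apply: eq_bigr => i _; rewrite scaler_sumr.
    by apply: eq_bigr => j _; rewrite scalerA rmorphM /= conjCi !mulrA.
  move: h; rewrite E1 E2 -scalerBr => /eqP.
  rewrite scaler_eq0 (negbTE (neq0Ci C)) /= subr_eq0 => /eqP lm.
  have /eqP := BD l m; rewrite -lm -mulr2n -scaler_nat scaler_eq0 pnatr_eq0 /=.
  by move/eqP.
move=> i j; have := B0 (fun k => (k == i)%:R) (fun k => (k == j)%:R).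
rewrite /B (bigD1 i) //= [X in _ + X]big1 => [|k /negbTE ki]; last first.
  by apply: big1 => l _; rewrite ki rmorph0 mul0r scale0r.
rewrite addr0 (bigD1 j) //= big1 => [|k /negbTE kj]; last by rewrite kj mulr0 scale0r.
by rewrite !eqxx rmorph1 mulr1 scale1r addr0.
Qed.

Local Notation ctr X := ((map_mx Num.conj X)^T).

Lemma ctrM m n p (X : 'M[C]_(m, n)) (Y : 'M[C]_(n, p)) : ctr (X *m Y) = ctr Y *m ctr X.
Proof. by rewrite map_mxM trmx_mul. Qed.

(** Polarization makes [G] hermitian, and [L = sqrt (D + d) P] comes from its spectral
    decomposition. The case [d = 0] serves for Gram factorisations, [d > 0] for normalising a Choi
    matrix. *)
Lemma psd_factor n (G : 'M[C]_n) (d : C) : 0 <= d ->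
  (forall v : 'cV_n, 0 <= (ctr v *m G *m v) 0 0) ->
  exists L : 'M[C]_n, ctr L *m L = G + d%:M /\ (0 < d -> L \in unitmx).
Proof.
move=> d0 Gpos.
have ctrE (X : 'M[C]_n) : ctr X = map_mx Num.conj X^T by rewrite map_trmx.
have qE (X : 'M[C]_n) (v : 'cV_n) :
    (ctr v *m X *m v) 0 0 = \sum_i \sum_j ((v i 0)^* * v j 0) * X i j.
  rewrite mxE exchange_big /=; apply: eq_bigr => j _.
  rewrite mxE mulr_suml; apply: eq_bigr => i _; rewrite !mxE.
  by rewrite [RHS]mulrAC.
have Gherm : ctr G = G.
  apply/matrixP => i j; apply/eqP; rewrite -subr_eq0; apply/eqP; move: i j.
  apply: (polarization (V := C^o) (x := fun i j => ctr G i j - G i j)) => l.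
  pose v : 'cV_n := \col_i l i.
  have h : \sum_i \sum_j ((l i)^* * l j) * G i j = (ctr v *m G *m v) 0 0.
    by rewrite qE; apply: eq_bigr => i _; apply: eq_bigr => j _; rewrite !mxE.
  have h' : \sum_i \sum_j ((l i)^* * l j) * ctr G i j = ((ctr v *m G *m v) 0 0)^*%R.
    rewrite -h rmorph_sum exchange_big /=; apply: eq_bigr => i _.
    rewrite rmorph_sum; apply: eq_bigr => j _.
    by rewrite !mxE !rmorphM /= conjCK [_ * l i]mulrC.
  transitivity (((ctr v *m G *m v) 0 0)^*%R - (ctr v *m G *m v) 0 0).
    rewrite -{2}h -h' -sumrB; apply: eq_bigr => i _; rewrite -sumrB.
    by apply: eq_bigr => j _; exact: mulrBr.
  by rewrite (CrealP (ger0_real (Gpos v))) subrr.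
have Gn : G \is normalmx by apply/normalmxP; rewrite -ctrE Gherm.
have GE := orthomx_spectralP Gn; set P := spectralmx G in GE; set D := spectral_diag G in GE.
have PU : P *m ctr P = 1%:M by rewrite ctrE; apply/unitarymxP/spectral_unitarymx.
have PU' : ctr P *m P = 1%:M by apply: mulmx1C.
have iP : invmx P = ctr P by rewrite ctrE invmx_unitary // spectral_unitarymx.
have D0 i : 0 <= D 0 i.
  have PG : P *m G *m ctr P = diag_mx D by rewrite GE iP !mulmxA PU mul1mx -mulmxA PU mulmx1.
  have := Gpos (ctr (row i P)).
  have -> : (ctr (ctr (row i P)) *m G *m ctr (row i P)) 0 0 = (P *m G *m ctr P) i i.
    rewrite mxE [RHS]mxE; apply: eq_bigr => k _; rewrite !mxE; congr (_ * _).
    by apply: eq_bigr => l _; rewrite !mxE conjCK.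
  by rewrite PG mxE eqxx mulr1n.
pose L := diag_mx (\row_i sqrtC (D 0 i + d)) *m P.
exists L; split.
  have -> : G + d%:M = ctr P *m diag_mx (\row_i (D 0 i + d)) *m P.
    rewrite GE iP.
    have -> : diag_mx (\row_i (D 0 i + d)) = diag_mx D + d%:M.
      by apply/matrixP => i j; rewrite !mxE; case: eqP => [->|]; rewrite ?addr0 ?mulr1n.
    by rewrite mulmxDr mulmxDl -(scalemx1 _ d) -scalemxAr mulmx1 -scalemxAl PU'.
  rewrite /L ctrM !mulmxA -(mulmxA (ctr P)); congr (_ *m _ *m _).
  apply/matrixP => i j; rewrite mul_mx_diag !mxE.
  have [->|ij] := eqVneq i j; last by rewrite !mulr0n rmorph0 mul0r.
  rewrite !mulr1n geC0_conj ?sqrtC_ge0 ?addr_ge0 //.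
  by rewrite -expr2 sqrtCK.
move=> dp; rewrite unitmx_mul; apply/andP; split; last exact: spectral_unit.
rewrite unitmxE det_diag unitfE; apply/prodf_neq0 => i _; rewrite mxE sqrtC_eq0.
by rewrite gt_eqF // ltr_wpDl.
Qed.
End Factor.

(** * The Choi matrix of a positive functional, and what the ucp tests imply *)

Section States.
Variables (R : realType) (A : cstarAlgType R) (r : nat).
Local Notation cst := (@cst R A).
Local Notation ctr X := ((map_mx Num.conj X)^T).
Local Notation C := R[i].

(** Matrices over [A] are used as an [A]-module, so the imaginary unit enters as an element of
    [A]. *)
Definition cxi : A := ('i%C : C)%:A.

Lemma cscaleE (k : C) : k%:A = cst (complex.Re k) + cxi * cst (complex.Im k).
Proof.
rewrite /cst /cxi mulr_algl scalerA -scalerDl; congr (_ *: _).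
by case: k => a b; simpc.
Qed.

Lemma cxi_cst t : cxi * cst t = cst t * cxi. Proof. by rewrite cstC. Qed.

Lemma cxiM : cxi * cxi = -1.
Proof. by rewrite /cxi mulr_algl scalerA -(expr2 'i%C) sqr_i scaleN1r. Qed.

Lemma star_calg (k : C) : star (k%:A : A) = (k^*%R)%:A.
Proof. by rewrite starZ star1. Qed.

Lemma adj_calg m n (k : C) (x : 'M[A]_(m, n)) :
  adjmx (k%:A *: x) = (k^*%R)%:A *: adjmx x.
Proof. by apply/matrixP => i j; rewrite !mxE starM star_calg -scalerAr mulr1 mulr_algl. Qed.

(* Positivity is asked on the elements with positive real part, which makes [f]
   vanish on skew-adjoint elements. *)
Record posfun (f : 'M[A]_r -> R) : Prop := Posfun {
  posfunD : forall x y, f (x + y) = f x + f y;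
  posfunZ : forall t x, f (cst t *: x) = t * f x;
  posfun_ge0 : forall v, sos (v + adjmx v) -> 0 <= f v }.

(** The usual complex linear functional with real part [f]. *)
Definition complexify (f : 'M[A]_r -> R) (x : 'M[A]_r) : C := f x -i* f (cxi *: x).

Section Complexify.
Variable f : 'M[A]_r -> R.
Hypothesis hf : posfun f.
Local Notation F := (complexify f).

Lemma posfun0 : f 0 = 0.
Proof. by have := posfunZ hf 0 0; rewrite rmorph0 scale0r mul0r. Qed.

Lemma posfunN x : f (- x) = - f x.
Proof. by have := posfunZ hf (-1) x; rewrite rmorphN1 scaleN1r mulN1r. Qed.

Lemma posfun_skew x : x + adjmx x = 0 -> f x = 0.
Proof.
move=> x0; apply/eqP; rewrite eq_le -oppr_ge0 -posfunN.
by rewrite !(posfun_ge0 hf) ?x0 ?raddfN ?x0 /= -?opprD ?x0 ?oppr0 //; exact: sos0.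
Qed.

Lemma complexifyD x y : F (x + y) = F x + F y.
Proof. by rewrite /complexify scalerDr !(posfunD hf) opprD; simpc. Qed.

Lemma complexifyZ (k : C) x : F (k%:A *: x) = k * F x.
Proof.
rewrite /complexify scalerA cscaleE mulrDr mulrA cxiM mulN1r !scalerDl.
rewrite !cxi_cst -!scalerA scaleNr !(posfunD hf) posfunN !(posfunZ hf).
case: k => a b /=; simpc; congr (_ +i* _); ring.
Qed.

Lemma complexify0 : F 0 = 0.
Proof. by rewrite /complexify scaler0 posfun0 oppr0. Qed.

Lemma complexify_sum (I : Type) (s : seq I) (P : pred I) (G : I -> 'M[A]_r) :
  F (\sum_(i <- s | P i) G i) = \sum_(i <- s | P i) F (G i).
Proof. by apply: (big_morph F complexifyD complexify0). Qed.

Lemma complexify_sos x : sos x -> F x = (f x)%:C.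
Proof.
move=> sx; rewrite /complexify (posfun_skew (x := cxi *: x)) ?oppr0 //.
rewrite adj_calg (sos_adj sx) -scalerDl -scalerDl.
rewrite (_ : _ + _ = 0) ?scale0r ?scale0r //.
by apply/eqP; rewrite eq_complex /= !addr0 subrr !eqxx.
Qed.

Lemma complexify_sos_ge0 x : sos x -> 0 <= F x.
Proof.
move=> sx; rewrite complexify_sos // lecR; apply: (posfun_ge0 hf).
by rewrite (sos_adj sx); exact: sosD.
Qed.

Lemma complexify_entries (m : 'M[A]_r) :
  F m = \sum_i \sum_j F (m i j *: delta_mx i j).
Proof.
rewrite {1}(matrix_sum_delta m) complexify_sum; apply: eq_bigr => i _.
by rewrite complexify_sum.
Qed.

Definition choi (a : A) : 'M[C]_r := \matrix_(i, j) F (a *: delta_mx i j).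

Lemma choi_linear : linear choi.
Proof.
move=> k a b; apply/matrixP => i j; rewrite !mxE.
by rewrite -mulr_algl scalerDl -scalerA complexifyD complexifyZ.
Qed.

(** With the scalar vectors [w k] as rows of [W], the form equals [F (W^* x W)], again [F] of a sum
    of hermitian squares. *)
Lemma choi_cp n (x : 'M[A]_n) (w : 'I_n -> 'cV[C]_r) : sos x ->
  0 <= \sum_k \sum_l (ctr (w k) *m choi (x k l) *m w l) 0 0.
Proof.
move=> [N [y xE]]; pose W : 'M[A]_(n, r) := \matrix_(k, i) (w k i 0)%:A.
suff -> : \sum_k \sum_l (ctr (w k) *m choi (x k l) *m w l) 0 0 =
    F (adjmx (y *m W) *m (y *m W)) by apply: complexify_sos_ge0; exact: sos_intro.
have -> : adjmx (y *m W) *m (y *m W) = adjmx W *m x *m W.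
  by rewrite xE adjmxM !mulmxA.
rewrite complexify_entries.
have E i j : F ((adjmx W *m x *m W) i j *: delta_mx i j) =
    \sum_k \sum_l (w k i 0)^*%R * w l j 0 * F (x k l *: delta_mx i j).
  rewrite mxE exchange_big /= scaler_suml complexify_sum; apply: eq_bigr => l _.
  rewrite mxE mulr_suml scaler_suml complexify_sum; apply: eq_bigr => k _.
  rewrite -complexifyZ scalerA; congr (F (_ *: _)).
  by rewrite !mxE star_calg mulr_algl mulr_algl -scalerAr mulr1 scalerA mulrC.
have E2 k l : (ctr (w k) *m choi (x k l) *m w l) 0 0 =
    \sum_i \sum_j (w k i 0)^*%R * w l j 0 * F (x k l *: delta_mx i j).
  rewrite mxE exchange_big /=; apply: eq_bigr => j _; rewrite mxE mulr_suml.
  by apply: eq_bigr => i _; rewrite !mxE mulrAC.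
rewrite (eq_bigr _ (fun k _ => eq_bigr _ (fun l _ => E2 k l))).
rewrite [RHS](eq_bigr _ (fun i _ => eq_bigr _ (fun j _ => E i j))).
under eq_bigr do rewrite exchange_big.
rewrite exchange_big; apply: eq_bigr => i _ /=.
under eq_bigr do rewrite exchange_big.
by rewrite exchange_big.
Qed.

Variable M : 'M[C]_r.

Definition compressed_choi (a : A) : 'M[C]_r := ctr M *m choi a *m M.

Lemma compressed_choi_linear : linear compressed_choi.
Proof.
move=> k a b; rewrite /compressed_choi choi_linear.
by rewrite mulmxDr mulmxDl -scalemxAr -scalemxAl.
Qed.

HB.instance Definition _ :=
  GRing.isLinear.Build C A 'M[C]_r *:%R compressed_choi compressed_choi_linear.

Lemma compressed_choi_ucp : ctr M *m choi 1 *m M = 1%:M ->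
  ucp (S := cstar_opsys A) compressed_choi.
Proof.
move=> M1; split=> // n x [y xE] v.
rewrite (_ : map_mx _ x = x) in xE; last by apply/matrixP => i j; rewrite mxE.
have := choi_cp (fun k => M *m v k) (ex_intro _ n (ex_intro _ y xE) : sos x).
congr (0 <= _); apply: eq_bigr => k _; apply: eq_bigr => l _.
rewrite (_ : map_mx _ x k l = ctr M *m choi (x k l) *m M); last by rewrite mxE.
by rewrite ctrM !mulmxA.
Qed.

End Complexify.

(** The ucp map [M^* choi M] with [M = L^-1] is tested at the vectors [L e_i]: the normalisation
    cancels, and the form collapses to the sum of the [F (b_ij E_ij)], that is [F b]. *)
Lemma functional_test f (L : 'M[C]_r) (b : 'M[A]_r) : posfun f ->
  L \in unitmx -> ctr L *m L = choi f 1 ->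
  (forall q (psi : {linear cstar_opsys A -> 'M[C]_q}), ucp psi -> mxpos (map_mx psi b)) ->
  0 <= complexify f b.
Proof.
move=> hf Lu LL hb; pose M := invmx L.
have LM : L *m M = 1%:M by rewrite mulmxV.
have uM : ctr M *m choi f 1 *m M = 1%:M.
  by rewrite -LL !mulmxA -ctrM LM map_mx1 trmx1 mul1mx LM.
have := hb _ _ (compressed_choi_ucp hf uM) (fun i => L *m delta_mx i 0).
rewrite complexify_entries //; congr (0 <= _); apply: eq_bigr => i _; apply: eq_bigr => j _.
rewrite (_ : map_mx _ b i j = ctr M *m choi f (b i j) *m M); last by rewrite mxE.
rewrite !mulmxA -(mulmxA _ M L) mulVmx // mulmx1 -ctrM mulmxA mulVmx // mul1mx.
have -> : ctr (delta_mx i 0 : 'cV[C]_r) = delta_mx 0 i.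
  by apply/matrixP => k l; rewrite !mxE rmorph_nat andbC.
by rewrite -rowE -colE !mxE.
Qed.

Lemma sos_trace n (x : 'M[A]_n) : sos x -> sos ((\tr x)%:M : 'M[A]_r).
Proof.
move=> [N [y ->]]; rewrite /mxtrace raddf_sum; apply: big_ind => //.
- exact: sos0.
- exact: sosD.
move=> i _; rewrite mxE raddf_sum; apply: big_ind => //.
- exact: sos0.
- exact: sosD.
move=> k _ /=; rewrite adjmxE scalar_mxM; exists r, (y k i)%:M.
by rewrite adj_scalar_mx.
Qed.

Lemma ge0_of_perturb (z w : C) : (forall d : R, 0 < d -> 0 <= z + d%:C * w) -> 0 <= z.
Proof.
case: z => a b; case: w => c d h.
have {}h t : 0 < t -> b + t * d = 0 /\ 0 <= a + t * c.
  by move=> /h; rewrite lecE /= !mul0r subr0 addr0 => /andP[/eqP -> ->].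
(* Nonnegativity includes being real, and two values of the parameter already force the imaginary
   part of [z] to vanish. *)
have [h1 _] := h 1 ltr01; have [h2 _] := h 2 (ltr0Sn R 1).
rewrite lecE /=; apply/andP; split; first by apply/eqP; lra.
rewrite leNgt; apply/negP => a0.
have cp : 0 < `|c| + 1 by rewrite ltr_wpDl.
have t0 : 0 < - a / 2 / (`|c| + 1) by rewrite !divr_gt0 ?oppr_gt0.
have [_] := h _ t0; have c1 : c <= `|c| + 1 by have := ler_norm c; lra.
have := ler_wpM2l (ltW t0) c1; rewrite divfK ?gt_eqF //; lra.
Qed.

(* The perturbation makes [choi f 1] invertible, so that the completely positive
   map [choi f] can be normalised into a unital one. *)
Lemma posfun_perturb f d : posfun f -> 0 <= d ->
  posfun (fun x => f x + d * f ((\tr x)%:M)).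
Proof.
move=> hf d0; split=> [x y|t x|v sv].
- by rewrite !raddfD /= !(posfunD hf) mulrDr addrACA.
- by rewrite mxtraceZ -scale_scalar_mx !(posfunZ hf) mulrDr mulrCA.
- apply: addr_ge0; first exact: (posfun_ge0 hf).
  apply: mulr_ge0 => //; apply: (posfun_ge0 hf).
  rewrite adj_scalar_mx -raddfD /=; have := sos_trace sv.
  rewrite raddfD /=; congr (sos (_ + _)%:M).
  rewrite /mxtrace raddf_sum; apply: eq_bigr => i _.
  by rewrite adjmxE.
Qed.

Lemma positive_of_ucp_tests f (b : 'M[A]_r) : posfun f -> f 1%:M = 1 ->
  (forall q (psi : {linear cstar_opsys A -> 'M[C]_q}), ucp psi -> mxpos (map_mx psi b)) ->
  0 <= complexify f b.
Proof.
move=> hf f1 hb; apply: (ge0_of_perturb (w := complexify f ((\tr b)%:M))) => d d0.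
(* The trace of [E_ij] is the Kronecker delta and [f 1 = 1], so the added term shifts [choi f 1] by
   exactly [d]. *)
pose f' x := f x + d * f ((\tr x)%:M).
have F'E x : complexify f' x = complexify f x + d%:C * complexify f ((\tr x)%:M).
  rewrite /complexify /f' mxtraceZ -scale_scalar_mx.
  by apply/eqP; rewrite eq_complex /= !mul0r subr0 addr0 mulrN opprD !eqxx.
have hf' : posfun f' by apply: posfun_perturb => //; exact: ltW.
have [|v|L [LL Lu]] := @psd_factor _ r (choi f 1) d%:C; first by rewrite lecR ltW.
  have := choi_cp hf (n := 1) (x := 1%:M) (fun=> v) (@sos1 _ _ _).
  by rewrite !big_ord1 (_ : 1%:M 0 0 = 1) // mxE.
rewrite -F'E; apply: functional_test hf' _ _ hb; first by apply: Lu; rewrite ltcR.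
rewrite LL; apply/matrixP => i j; rewrite !mxE F'E; congr (_ + _).
rewrite scale1r; have [->|ij] := eqVneq i j.
  have -> : \tr (delta_mx j j : 'M[A]_r) = 1.
    rewrite /mxtrace (bigD1 j) //= mxE !eqxx big1 ?addr0 // => k /negbTE kj.
    by rewrite mxE kj.
  by rewrite (complexify_sos hf (sos1 _ _)) f1 mulr1.
have -> : \tr (delta_mx i j : 'M[A]_r) = 0.
  rewrite /mxtrace big1 // => k _; rewrite mxE.
  by case: eqP => // ->; rewrite (negbTE ij).
by rewrite (raddf0 (@scalar_mx A r)) (complexify0 hf) mulr0.
Qed.

(** Separation is applied to the wedge of all [v] whose [v + v^*] is a sum of squares, so [z] need
    not be self-adjoint. A separating [f] would have [f z <= - e < 0]. *)
Lemma sos_of_functionals (z : 'M[A]_r) e : 0 < e ->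
  (forall f, posfun f -> f 1%:M = 1 -> 0 <= f z) ->
  sos ((z + (cst e)%:M) + adjmx (z + (cst e)%:M)).
Proof.
move=> e0 h; apply: contrapT => nz.
have [||v|f [fD fZ fC f1 fz]] := @positive_functional R A cst _ 1%:M
    (fun v => sos (v + adjmx v)) (z + (cst e)%:M) _ _ _ nz.
- split=> [x y sx sy|t x t0 sx]; first by rewrite raddfD /= addrACA; exact: sosD.
  by rewrite adj_scale_cst -scalerDr; exact: sosZ.
- by rewrite adj_scalar_mx star1; apply: sosD; exact: sos1.
- have [t [t0 ht]] := sos_order_unit v; exists (t / 2).
  rewrite scale_scalar_mx mulr1 raddfB /= adj_scalar_mx star_cst addrACA -raddfD /= cstD.
  by rewrite -opprD -splitr.
have hf : posfun f by split.
have := h f hf f1; move: fz; rewrite fD -[cst e]mulr1 -scale_scalar_mx fZ f1; lra.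
Qed.

Lemma sos_sandwich m n (x : 'M[A]_m) (W : 'M[A]_(m, n)) :
  sos x -> sos (adjmx W *m x *m W).
Proof. by move=> [N [y ->]]; exists N, (y *m W); rewrite adjmxM !mulmxA. Qed.

(** By polarization it suffices that [q = W^* k W] vanishes for scalar columns [W]. The two order
    bounds give [|q| <= |W^* W| e] by [cnorm_le_of_pos]. *)
Lemma sos_small_eq0 n (k : 'M[A]_n) :
  (forall e, 0 < e -> sos (k + (cst e)%:M) /\ sos (- k + (cst e)%:M)) -> k = 0.
Proof.
move=> hk; have sk : adjmx k = k.
  have [/sos_adj + _] := hk 1 ltr01.
  by rewrite raddfD /= adj_scalar_mx star_cst => /addIr.
apply/matrixP => i j; rewrite [RHS]mxE; move: i j; apply: polarization => l.
pose W : 'cV[A]_n := \col_i (l i)%:A.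
have WE (x : 'M[A]_n) : (adjmx W *m x *m W) 0 0 = \sum_i \sum_j ((l i)^* * l j) *: x i j.
  rewrite mxE exchange_big /=; apply: eq_bigr => j _; rewrite mxE mulr_suml.
  apply: eq_bigr => i _; rewrite !mxE star_calg mulr_algl -scalerAl -scalerAr mulr1.
  by rewrite scalerA.
rewrite -WE; set q := (_ *m W) 0 0; pose w := (adjmx W *m W) 0 0.
have pw : pos w by apply: sos_pos; exact: sos_intro.
have sq : star q = q by rewrite /q -adjmxE !adjmxM adjmxK sk mulmxA.
have bound (x : 'M[A]_n) e : 0 < e -> sos (x + (cst e)%:M) ->
    pos (cst (cnorm w * e) + (adjmx W *m x *m W) 0 0).
  move=> e0 /(sos_sandwich W) /sos_pos.
  rewrite mulmxDr mulmxDl -[cst e]mulr1 -scale_scalar_mx mulmx_cst mulmx1 -scalemxAl.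
  rewrite [X in pos X -> _]mxE [X in pos (_ + X) -> _]mxE -/w => h.
  have pc : pos (cst e * (cst (cnorm w) - w)).
    by apply: posZ; [exact: ltW | apply: pos_bound => //; exact: pos_star].
  have := posD h pc; rewrite mulrBr cstM (mulrC e) -addrA subrKC addrC.
  by [].
apply: (cnorm_small (K := cnorm w)) => e e0; have [h1 h2] := hk e e0.
apply: cnorm_le_of_pos => //; first by rewrite mulr_ge0 ?cnorm_ge0 // ltW.
  have := bound _ _ e0 h2; rewrite mulmxN mulNmx.
  by rewrite [X in pos (_ + X) -> _]mxE.
exact: bound.
Qed.

Lemma sos_of_ucp_tests (a : 'M[A]_r) :
  (forall q (psi : {linear cstar_opsys A -> 'M[C]_q}), ucp psi -> mxpos (map_mx psi a)) ->
  adjmx a = a /\ forall e, 0 < e -> sos (a + (cst e)%:M).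
Proof.
move=> ha.
have ReIm f : posfun f -> f 1%:M = 1 -> 0 <= f a /\ f (cxi *: a) = 0.
  move=> hf f1; have := positive_of_ucp_tests hf f1 ha.
  by rewrite lecE /= oppr_eq0 eq_sym => /andP[/eqP -> ->].
have halve x e : sos (x + (cst (e / 2))%:M + adjmx (x + (cst (e / 2))%:M)) ->
    sos (x + adjmx x + (cst e)%:M).
  rewrite raddfD /= adj_scalar_mx star_cst addrACA -raddfD /= cstD -splitr.
  by [].
have cs : star cxi = - cxi.
  rewrite star_calg /cxi -scaleNr; congr (_ *: _).
  by apply/eqP; rewrite eq_complex /= oppr0 !eqxx.
have adj_cxi : adjmx (cxi *: a) = - (cxi *: adjmx a).
  apply/matrixP => i j; rewrite !mxE starM cs mulrN /cxi mulr_algl -scalerAr mulr1.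
  by [].
(* Since [f] vanishes at [cxi *: a], both this element and its opposite pass the functional test.
   That its real part is zero says that [a] is self-adjoint. *)
have k0 : cxi *: a + adjmx (cxi *: a) = 0.
  apply: sos_small_eq0 => e e0; have e2 : 0 < e / 2 by rewrite divr_gt0.
  split; first by apply: halve; apply: sos_of_functionals => // f hf /(ReIm f hf)[_ ->].
  rewrite opprD -(raddfN (@adjmx R A r r)) /=; apply: halve; apply: sos_of_functionals => // f hf.
  by rewrite (posfunN hf) => /(ReIm f hf)[_ ->]; rewrite oppr0.
have sa : adjmx a = a.
  move/eqP: k0; rewrite adj_cxi subr_eq0 => /eqP /(congr1 (fun x => - cxi *: x)).
  by rewrite /= !scalerA mulNr cxiM opprK !scale1r => <-.
split=> // e e0; have e2 : 0 < e * 2 / 2 by rewrite mulfK ?pnatr_eq0.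
have : sos (a + adjmx a + (cst (e * 2))%:M).
  by apply: halve; apply: sos_of_functionals => // f hf /(ReIm f hf)[].
have i20 : (0 : R) <= 2^-1 by rewrite invr_ge0.
move=> /(sosZ i20); congr sos; rewrite sa -mulr2n -scaler_nat -(rmorph_nat cst).
rewrite scalerDr scalerA cstM mulVf ?pnatr_eq0 // rmorph1 scale1r.
by rewrite scale_scalar_mx cstM mulrC mulfK ?pnatr_eq0.
Qed.

End States.

(** * Tensor products *)

Section Kernels.
Variable R : realType.
Local Notation C := R[i].
Local Notation ctr X := ((map_mx Num.conj X)^T).

(** Kernels on arbitrary finite types let blocks and tensor factors be indexed by pairs instead of
    flattened ordinals. *)
Definition psd (I : finType) (K : I -> I -> C) : Prop :=
  forall u : I -> C, 0 <= \sum_i \sum_j (u i)^* * K i j * u j.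

Lemma psd_ext (I : finType) (K L : I -> I -> C) :
  (forall i j, K i j = L i j) -> psd K -> psd L.
Proof.
move=> KL hK u; have := hK u; congr (0 <= _).
by apply: eq_bigr => i _; apply: eq_bigr => j _; rewrite KL.
Qed.

Lemma psd_pullback (I J : finType) (K : J -> J -> C) (X : J -> I -> C) : psd K ->
  psd (fun i i' => \sum_j \sum_j' (X j i)^* * K j j' * X j' i').
Proof.
move=> hK u; have := hK (fun j => \sum_i X j i * u i); congr (0 <= _).
transitivity (\sum_j \sum_j' \sum_i \sum_i' (u i)^* * ((X j i)^* * K j j' * X j' i') * u i').
  apply: eq_bigr => j _; apply: eq_bigr => j' _.
  rewrite rmorph_sum !mulr_suml; apply: eq_bigr => i _; rewrite mulr_sumr.
  by apply: eq_bigr => i' _; rewrite rmorphM /=; ring.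
under eq_bigr do rewrite exchange_big.
rewrite exchange_big; apply: eq_bigr => i _ /=.
under eq_bigr do rewrite exchange_big.
rewrite exchange_big; apply: eq_bigr => i' _ /=.
rewrite mulr_sumr mulr_suml; apply: eq_bigr => j _.
by rewrite mulr_sumr mulr_suml.
Qed.

Lemma sum_pair_delta (I J : finType) (g : I * J -> C) a :
  \sum_z g z * (z.2 == a)%:R = \sum_i g (i, a).
Proof.
transitivity (\sum_i \sum_j g (i, j) * (j == a)%:R).
  by rewrite pair_big; apply: eq_bigr => -[i j].
apply: eq_bigr => i _; rewrite (bigD1 a) //= eqxx mulr1 big1 ?addr0 // => j /negbTE ja.
by rewrite ja mulr0.
Qed.

Lemma psd_comp (I J : finType) (K : J -> J -> C) (f : I -> J) : psd K ->
  psd (fun i i' => K (f i) (f i')).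
Proof.
move=> /(psd_pullback (fun j i => (j == f i)%:R)); apply: psd_ext => i i'.
rewrite (bigD1 (f i)) //= [X in _ + X]big1 ?addr0 => [|j /negbTE ji]; last first.
  by apply: big1 => j' _; rewrite ji rmorph0 !mul0r.
rewrite (bigD1 (f i')) //= big1 ?addr0 => [|j' /negbTE ji]; last by rewrite ji mulr0.
by rewrite !eqxx rmorph1 mul1r mulr1.
Qed.

Lemma psd_gram (I : finType) (K : I -> I -> C) : psd K ->
  exists n (l : 'I_n -> I -> C), forall i j, K i j = \sum_m (l m i)^* * l m j.
Proof.
move=> hK; pose G : 'M[C]_#|I| := \matrix_(i, j) K (enum_val i) (enum_val j).
have [||L [LL _]] := @psd_factor _ _ G 0 => // [v|].
  have := psd_comp (@enum_val _ (mem I)) hK (fun i => v i 0); congr (0 <= _).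
  rewrite mxE exchange_big; apply: eq_bigr => j _; rewrite mxE mulr_suml.
  by apply: eq_bigr => i _; rewrite !mxE.
exists #|I|, (fun m i => L m (enum_rank i)) => i j.
have /matrixP/(_ (enum_rank i) (enum_rank j)) := LL.
rewrite !mxE !enum_rankK mul0rn addr0 => <-.
by apply: eq_bigr => m _; rewrite !mxE.
Qed.

(** A Gram factorisation of [K] writes the form as a sum of values of the form of [L]. *)
Lemma psd_tensor (I J : finType) (K : I -> I -> C) (L : J -> J -> C) :
  psd K -> psd L -> psd (fun x y : I * J => K x.1 y.1 * L x.2 y.2).
Proof.
move=> /psd_gram[n [l lE]] hL u.
suff -> : \sum_x \sum_y (u x)^* * (K x.1 y.1 * L x.2 y.2) * u y =
    \sum_m \sum_j \sum_j' (\sum_i l m i * u (i, j))^* * L j j' * (\sum_i l m i * u (i, j')).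
  by apply: sumr_ge0 => m _; exact: hL.
transitivity (\sum_m \sum_x \sum_y (l m x.1 * u x)^* * L x.2 y.2 * (l m y.1 * u y)).
  rewrite [RHS]exchange_big; apply: eq_bigr => x _; rewrite [RHS]exchange_big.
  apply: eq_bigr => y _ /=; rewrite lE mulr_suml mulr_sumr mulr_suml; apply: eq_bigr => m _.
  by rewrite rmorphM /=; ring.
apply: eq_bigr => m _.
transitivity (\sum_j \sum_i \sum_j' \sum_i' (l m i * u (i, j))^* * L j j' * (l m i' * u (i', j'))).
  rewrite [RHS]exchange_big pair_big; apply: eq_bigr => -[i j] _ /=.
  by rewrite [RHS]exchange_big pair_big; apply: eq_bigr => -[i' j'] _.
apply: eq_bigr => j _; rewrite exchange_big; apply: eq_bigr => j' _ /=.
rewrite rmorph_sum !mulr_suml; apply: eq_bigr => i _.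
by rewrite mulr_sumr.
Qed.

Lemma mxpos_psd r k (B : 'M['M[C]_k]_r) :
  mxpos B <-> psd (fun x y : 'I_r * 'I_k => B x.1 y.1 x.2 y.2).
Proof.
have E (v : 'I_r -> 'I_k -> C) (w : 'I_r -> 'cV[C]_k) : (forall i a, w i a 0 = v i a) ->
    \sum_i \sum_j (ctr (w i) *m B i j *m w j) 0 0 =
    \sum_(x : 'I_r * 'I_k) \sum_(y : 'I_r * 'I_k) (v x.1 x.2)^* * B x.1 y.1 x.2 y.2 * v y.1 y.2.
  move=> wv; transitivity (\sum_i \sum_a \sum_j \sum_b (v i a)^* * B i j a b * v j b).
    apply: eq_bigr => i _; rewrite exchange_big; apply: eq_bigr => j _ /=.
    rewrite mxE exchange_big; apply: eq_bigr => b _ /=.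
    by rewrite mxE mulr_suml; apply: eq_bigr => a _; rewrite !mxE !wv.
  by rewrite pair_big; apply: eq_bigr => x _; rewrite pair_big.
split=> [h u|h v].
  have := h (fun i => \col_a u (i, a)).
  rewrite (E (fun i a => u (i, a))) => [|i a]; last by rewrite mxE.
  by congr (0 <= _); apply: eq_bigr => -[i a] _; apply: eq_bigr => -[j b] _.
by rewrite (E (fun i a => v i a 0)) //; have := h (fun x => v x.1 x.2 0).
Qed.
End Kernels.

(** * The maximal cone lies in the minimal cone *)

Section MaxMin.
Variables (R : realType) (S T : opsys R).
Local Notation C := R[i].

Lemma tensor_mapE p q (phi : {linear S -> 'M[C]_p}) (psi : {linear T -> 'M[C]_q}) s t :
  tensor_map phi psi (tens s t) = tensmx (phi s) (psi t).
Proof. by rewrite /tensor_map /= tensor_liftE. Qed.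

Lemma mxpos_perturb (V : lmodType C) k r (F : {linear V -> 'M[C]_k}) (x : 'M[V]_r) (w : V) :
  (forall e : R, 0 < e -> mxpos (map_mx F (x + (e%:C *: w)%:M))) -> mxpos (map_mx F x).
Proof.
move=> h v; pose Q (y : 'M[V]_r) :=
  \sum_i \sum_j ((map_mx Num.conj (v i))^T *m map_mx F y i j *m v j) 0 0.
apply: (@ge0_of_perturb R (Q x) (Q w%:M)) => e e0.
have -> : Q x + e%:C * Q w%:M = Q (x + (e%:C *: w)%:M); last exact: h.
rewrite /Q mulr_sumr -big_split; apply: eq_bigr => i _.
rewrite mulr_sumr -big_split; apply: eq_bigr => j _ /=.
have -> : map_mx F (x + (e%:C *: w)%:M) i j = map_mx F x i j + e%:C *: map_mx F w%:M i j.
  rewrite ![map_mx _ _ _ _]mxE [(x + _) i j]mxE [w%:M i j]mxE [(_ *: w)%:M i j]mxE.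
  by rewrite linearD /=; case: (i == j); rewrite ?mulr1n ?mulr0n ?linearZ ?linear0 ?scaler0.
by rewrite mulmxDr mulmxDl [in RHS]mxE -scalemxAr -scalemxAl [X in _ = _ + X]mxE.
Qed.

Lemma max_pre_mxpos r (x : 'M[tensor S T]_r) p q (phi : {linear S -> 'M[C]_p})
    (psi : {linear T -> 'M[C]_q}) : ucp phi -> ucp psi -> max_pre x ->
  mxpos (map_mx (tensor_map phi psi) x).
Proof.
move=> [_ hphi] [_ hpsi] [n [m [s [t [X [sp tp ->]]]]]].
apply/mxpos_psd.
have /mxpos_psd ks := hphi _ _ sp; have /mxpos_psd kt := hpsi _ _ tp.
have := psd_tensor ks kt.
(* The indices are shuffled to match the order of factors in [tensor_mx] and [tensmx]; the pullback
   that follows is compression by [X (x) 1]. *)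
move=> /(psd_comp (fun z : 'I_(n * m) * 'I_(p * q) =>
  (((mxtens_unindex z.1).1, (mxtens_unindex z.2).1),
   ((mxtens_unindex z.1).2, (mxtens_unindex z.2).2)))) /=.
move=> /(psd_pullback (fun (z : 'I_(n * m) * 'I_(p * q)) (y : 'I_r * 'I_(p * q)) =>
  X z.1 y.1 * (z.2 == y.2)%:R)).
apply: psd_ext => -[i a] [j b] /=.
transitivity (\sum_K \sum_L (X K i)^* * X L j *
    tensmx (phi (s (mxtens_unindex K).1 (mxtens_unindex L).1))
           (psi (t (mxtens_unindex K).2 (mxtens_unindex L).2)) a b).
  transitivity (\sum_(z : 'I_(n * m) * 'I_(p * q)) (\sum_L (X z.1 i)^* * X L j *
    tensmx (phi (s (mxtens_unindex z.1).1 (mxtens_unindex L).1))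
           (psi (t (mxtens_unindex z.1).2 (mxtens_unindex L).2)) z.2 b) * (z.2 == a)%:R).
    apply: eq_bigr => z _; rewrite -(sum_pair_delta (fun z' => (X z.1 i)^* * X z'.1 j *
      tensmx (phi (s (mxtens_unindex z.1).1 (mxtens_unindex z'.1).1))
           (psi (t (mxtens_unindex z.1).2 (mxtens_unindex z'.1).2)) z.2 z'.2)) mulr_suml.
    apply: eq_bigr => z' _; rewrite !mxE rmorphM /= rmorph_nat; ring.
  by rewrite (sum_pair_delta (fun z => \sum_L _)).
rewrite [map_mx _ _ i j]mxE [compression _ _ i j]mxE linear_sum summxE.
apply: eq_bigr => K _; rewrite linear_sum summxE; apply: eq_bigr => L _.
by rewrite linearZ /= [RHS]mxE [tensor_mx s t K L]mxE tensor_mapE.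
Qed.

Lemma max_pos_min_pos r (x : 'M[tensor S T]_r) : max_pos x -> min_pos x.
Proof.
move=> hx p q phi psi uphi upsi; apply: mxpos_perturb => e e0.
exact: max_pre_mxpos (hx e e0).
Qed.
End MaxMin.

(** * Slice maps [c (x) id] on a tensor product *)

Section TensorSlices.
Variables (K : fieldType) (V W : lmodType K).
Implicit Types (c : {linear V -> K^o}) (t : tensor V W).

Definition slice_pair c (v : V) (w : W) : W := (c v : K) *: w.

Lemma slice_pair_bilinear c : bilinear_for *:%R *:%R (slice_pair c).
Proof.
split=> [w a u v|v a w w']; rewrite /slice_pair.
  by rewrite linearP /= scalerDl scalerA.
by rewrite scalerDr scalerA mulrC -scalerA.
Qed.

HB.instance Definition _ c :=
  bilinear_isBilinear.Build K V W W *:%R *:%R (slice_pair c) (slice_pair_bilinear c).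

Definition slice c : {linear tensor V W -> W} := tensor_lift (slice_pair c).

Lemma sliceE c v w : slice c (tens v w) = (c v : K) *: w.
Proof. by rewrite /slice /= tensor_liftE. Qed.

Lemma tensor_ind (P : tensor V W -> Prop) : P 0 ->
  (forall v w t, P t -> P (tens v w + t)) -> forall t, P t.
Proof.
move=> P0 PS t; rewrite (tensor_sum t); elim: (repr t) => [|[v w] s IH].
  by rewrite big_nil.
by rewrite big_cons; exact: PS.
Qed.

Lemma slice_comb c c1 c2 (a b : K) t :
  (forall v, (c v : K) = a * c1 v + b * c2 v) ->
  slice c t = a *: slice c1 t + b *: slice c2 t.
Proof.
move=> cE; elim/tensor_ind: t => [|v w t IH]; first by rewrite !linear0 addr0.
by rewrite !linearD IH !sliceE cE scalerDl -!scalerA addrACA.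
Qed.

Lemma tensor_decomp (I : finType) (e : I -> V) (c : I -> {linear V -> K^o}) :
  (forall v, v = \sum_i (c i v : K) *: e i) ->
  forall t, t = \sum_i tens (e i) (slice (c i) t).
Proof.
move=> ve; elim/tensor_ind => [|v w t IH].
  by rewrite big1 // => i _; rewrite linear0 linear0r.
under eq_bigr do rewrite linearD linearDr.
rewrite big_split -IH; congr (_ + _); rewrite {1}(ve v) linear_sumlz.
by apply: eq_bigr => i _; rewrite sliceE linearZl_LR linearZr_LR.
Qed.
End TensorSlices.

Arguments slice {K V W} c.

(** * Coordinates of [W22] and the four slices of a tensor *)

Section Slices.
Variables (R : realType) (A : cstarAlgType R).
Local Notation C := R[i].
Local Notation W := (W22 R).
Local Notation WA := (tensor W (cstar_opsys A)).

Definition coord (k : 'I_4) (w : W) : C := os_emb W w k.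

Lemma coord_linear k : linear (coord k : W -> C^o).
Proof. by move=> a x y; rewrite /coord linearP !ffunE. Qed.

HB.instance Definition _ k :=
  GRing.isLinear.Build C W C^o *:%R (coord k : W -> C^o) (@coord_linear k).

Lemma coord_unit k : coord k (os_unit W) = 1.
Proof. by rewrite [LHS]ffunE. Qed.

Definition coordl k : {linear W -> C^o} := coord k.
Local Notation slicek k := (slice (coordl k) : {linear WA -> A}).

Definition coord_mx (k : 'I_4) (w : W) : 'M[C]_1 := (coord k w)%:M.

Lemma coord_mx_linear k : linear (coord_mx k).
Proof.
by move=> a x y; rewrite /coord_mx linearP /= raddfD /= scale_scalar_mx.
Qed.

HB.instance Definition _ k :=
  GRing.isLinear.Build C W 'M[C]_1 *:%R (coord_mx k) (@coord_mx_linear k).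

Lemma coord_mx_ucp k : ucp (coord_mx k).
Proof.
split=> [|n x [y xE]]; first by apply: (congr1 (fun c : C => c%:M)); exact: coord_unit.
apply/mxpos_psd => u.
have E (i j : 'I_n * 'I_1) : map_mx (coord_mx k) x i.1 j.1 i.2 j.2 =
    \sum_p (y p i.1 k)^* * y p j.1 k.
  rewrite mxE /coord_mx mxE !ord1 eqxx mulr1n /coord.
  have /matrixP/(_ i.1 j.1) := xE; rewrite mxE => ->.
  by rewrite mxE sum_ffunE; apply: eq_bigr => p _; rewrite !mxE !ffunE.
suff -> : \sum_i \sum_j (u i)^* * map_mx (coord_mx k) x i.1 j.1 i.2 j.2 * u j =
   \sum_p (\sum_j y p j.1 k * u j)^* * (\sum_j y p j.1 k * u j).
  by apply: sumr_ge0 => p _; rewrite mulrC mul_conjC_ge0.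
transitivity (\sum_i \sum_j \sum_p (u i)^* * ((y p i.1 k)^* * y p j.1 k) * u j).
  by apply: eq_bigr => i _; apply: eq_bigr => j _; rewrite E mulr_sumr mulr_suml.
under eq_bigr do rewrite exchange_big.
rewrite exchange_big; apply: eq_bigr => p _ /=.
rewrite rmorph_sum mulr_suml; apply: eq_bigr => i _; rewrite mulr_sumr.
by apply: eq_bigr => j _; rewrite rmorphM /=; ring.
Qed.

Lemma tensor_map_coord k q (psi : {linear cstar_opsys A -> 'M[C]_q}) (t : WA) :
  tensor_map (coord_mx k) psi t = tensmx (1%:M : 'M_1) (psi (slicek k t)).
Proof.
rewrite (tensor_sum t); elim: (repr t) => [|[w a] s IH]; first by rewrite big_nil !linear0 tensmx0.
rewrite big_cons !linearD IH tensor_mapE sliceE linearZ.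
by apply/matrixP => i j; rewrite !mxE !ord1 !eqxx !mulr1n !mul1r.
Qed.

(** The coordinate [k] is a ucp map into [M_1], so pairing it with [psi] in the minimal cone tests
    exactly the slice [k]. *)
Lemma min_pos_slice k r (x : 'M[WA]_r) : min_pos x ->
  forall q (psi : {linear cstar_opsys A -> 'M[C]_q}), ucp psi ->
  mxpos (map_mx psi (map_mx (slicek k) x)).
Proof.
move=> hx q psi upsi.
have /mxpos_psd := hx _ _ _ _ (coord_mx_ucp k) upsi.
move=> /(psd_comp (fun z : 'I_r * 'I_q => (z.1, mxtens_index (ord0 : 'I_1, z.2)))) h.
apply/mxpos_psd; apply: psd_ext h => -[i a] [j b] /=.
rewrite ![map_mx _ _ i j]mxE tensor_map_coord.
by rewrite mxE !mxtens_indexK mxE eqxx mul1r.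
Qed.

Definition w22_of (a b c d : C) (h : a + b = c + d) : W.
Proof.
exists [ffun k : 'I_4 => [:: a; b; c; d]`_k].
by rewrite W22_predE !ffunE /= h.
Defined.

Definition w_e : W := @w22_of 1 (-1) 0 0 (etrans (subrr 1) (esym (addr0 0))).
Definition w_f : W := @w22_of 0 0 1 (-1) (etrans (addr0 0) (esym (subrr 1))).

Lemma W22_inj (v w : W) : (forall k, coord k v = coord k w) -> v = w.
Proof. by move=> h; apply: (os_emb_inj (o := W)); apply/ffunP. Qed.

Lemma coord_rel (w : W) : coord 0 w + coord 1 w = coord 2 w + coord 3 w.
Proof. by case: w => v vW; apply/eqP. Qed.

Lemma forall_I4 (P : 'I_4 -> Prop) : P 0 -> P 1 -> P 2 -> P 3 -> forall k, P k.
Proof.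
move=> h0 h1 h2 h3 [[|[|[|[|//]]]] k4].
- by rewrite (_ : Ordinal k4 = 0) //; exact: val_inj.
- by rewrite (_ : Ordinal k4 = 1) //; exact: val_inj.
- by rewrite (_ : Ordinal k4 = 2) //; exact: val_inj.
- by rewrite (_ : Ordinal k4 = 3) //; exact: val_inj.
Qed.

Lemma coord_e k : coord k w_e = [:: 1; -1; 0; 0]`_k.
Proof. by rewrite /coord ffunE. Qed.

Lemma coord_f k : coord k w_f = [:: 0; 0; 1; -1]`_k.
Proof. by rewrite /coord ffunE. Qed.

Definition half_comb (k l : 'I_4) (b : C) (w : W) : C^o := 2^-1 * coord k w + b * coord l w.

Lemma half_comb_linear k l b : linear (half_comb k l b).
Proof.
move=> a x y; rewrite /half_comb -![coord _ _]/(coordl _ _) !linearP /=.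
by rewrite /GRing.scale /=; ring.
Qed.

HB.instance Definition _ k l b :=
  GRing.isLinear.Build C W C^o *:%R (half_comb k l b) (@half_comb_linear k l b).

Definition w22_basis (i : 'I_3) : W := [:: os_unit W; w_e; w_f]`_i.
(** The basis dual to [1, w_e, w_f]: [(x_0 + x_1) / 2], [(x_0 - x_1) / 2] and [(x_2 - x_3) / 2]. *)
Definition w22_coord (i : 'I_3) : {linear W -> C^o} :=
  nth (half_comb 0 0 0 : {linear W -> C^o})
    [:: half_comb 0 1 2^-1 : {linear W -> C^o}; half_comb 0 1 (- 2^-1) : {linear W -> C^o};
        half_comb 2 3 (- 2^-1) : {linear W -> C^o}] i.

Lemma w22_decomp (w : W) : w = \sum_i (w22_coord i w : C) *: w22_basis i.
Proof.
rewrite !big_ord_recr big_ord0 /= add0r; apply: W22_inj => k.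
rewrite -![coord k _]/(coordl k _) !linearD !linearZ /= /half_comb coord_unit coord_e coord_f.
rewrite /GRing.scale /=.
have h : coord 0 w = coord 2 w + coord 3 w - coord 1 w by rewrite -coord_rel addrK.
move: k; apply: forall_I4 => /=.
- by field.
- by field.
- by rewrite h; field.
- by rewrite h; field.
Qed.

Lemma w22_tensor (t : WA) : let a := fun k : 'I_4 => slicek k t in
  a 0 + a 1 = a 2 + a 3 /\
  t = tens (os_unit W) ((2^-1 : C) *: (a 0 + a 1)) + tens w_e ((2^-1 : C) *: (a 0 - a 1)) +
      tens w_f ((2^-1 : C) *: (a 2 - a 3)).
Proof.
have half k l b : slice (half_comb k l b) t =
    (2^-1 : C) *: slicek k t + b *: slicek l t.
  exact: slice_comb.
split.
  have E : slice (half_comb 0 1 2^-1) t = slice (half_comb 2 3 2^-1) t.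
    rewrite half; apply/esym; apply: slice_comb => w /=.
    by rewrite /half_comb -!mulrDr coord_rel.
  have := congr1 (fun x => (2 : C) *: x) E; rewrite !half -!scalerDr !scalerA.
  by rewrite divff ?pnatr_eq0 // !scale1r.
rewrite {1}(tensor_decomp w22_decomp t) !big_ord_recr big_ord0 /= add0r.
by rewrite !half !scaleNr -!scalerDr -!scalerBr.
Qed.
End Slices.

(** * The path matrix *)

Section Gram.
Variables (R : realType) (S : opsys R) (A : cstarAlgType R).
Local Notation C := R[i].
Local Notation T := (cstar_opsys A).

Lemma big_mxtens (V : nmodType) m n (F : 'I_(m * n) -> V) :
  \sum_k F k = \sum_i \sum_j F (mxtens_index (i, j)).
Proof.
rewrite pair_big /= (reindex (@mxtens_index m n)) //=.
  by apply: eq_bigr => -[i j].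
by exists (@mxtens_unindex m n) => k _; [exact: mxtens_indexK | exact: mxtens_unindexK].
Qed.

(* Padding with zero rows and columns turns the rectangular [b] into the square
   factor that [os_pos] asks for. *)
Lemma max_pre_gram n N r (s : 'M[S]_n) (b : 'I_n -> 'M[A]_(N, r)) : os_pos s ->
  @max_pre R S T r
    (\matrix_(k, l) \sum_i \sum_j tens (s i j) ((adjmx (b i) *m b j) k l : T)).
Proof.
move=> sp.
pose B : 'M[A]_(N, n * r) :=
  \matrix_(a, K) b (mxtens_unindex K).1 a (mxtens_unindex K).2.
pose Y : 'M[A]_(N + n * r) := block_mx 0 B 0 0.
(* [X] selects the rows [(i, (i, l))], which ties the block index of the Gram matrix to the index of
   [s]. *)
pose X : 'M[C]_(n * (N + n * r), r) := \matrix_(P, l)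
  ((mxtens_unindex P).2 == rshift N (mxtens_index ((mxtens_unindex P).1, l)))%:R.
exists n, (N + n * r)%N, s, (adjmx Y *m Y), X; split => //.
  by exists Y; apply/matrixP => i j; rewrite mxE.
have YE i j k l : (adjmx Y *m Y) (rshift N (mxtens_index (i, k)))
    (rshift N (mxtens_index (j, l))) = (adjmx (b i) *m b j) k l.
  rewrite mxE big_split_ord /= addrC big1 ?add0r => [|a _]; last first.
    by rewrite [X in _ * X]block_mxEdr [X in _ * X]mxE mulr0.
  rewrite [RHS]mxE; apply: eq_bigr => a _.
  by rewrite !adjmxE !block_mxEur !mxE !mxtens_indexK.
apply/matrixP => k l; rewrite [LHS]mxE [RHS]mxE big_mxtens; apply: eq_bigr => i _.
rewrite (bigD1 (rshift N (mxtens_index (i, k)))) //= [X in _ + X]big1 => [|P /negbTE Pk]; last first.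
  by apply: big1 => Q _; rewrite [X _ k]mxE mxtens_indexK /= Pk rmorph0 mul0r scale0r.
rewrite addr0 big_mxtens; apply: eq_bigr => j _.
rewrite (bigD1 (rshift N (mxtens_index (j, l)))) //= big1 => [|P /negbTE Pl]; last first.
  by rewrite [X _ l]mxE mxtens_indexK /= Pl mulr0 scale0r.
rewrite addr0 [X _ k]mxE [X _ l]mxE [in X in _ *: X]mxE !mxtens_indexK /= !eqxx rmorph1.
by rewrite mul1r scale1r YE.
Qed.
End Gram.

Section ChainMatrix.
Variable R : realType.
Local Notation C := R[i].
Local Notation W := (W22 R).

Definition partner (b : bool) (i : nat) : nat := if odd i == b then i.+1 else i.-1.

(* The vertices [0, ..., n - 1] form a path; [partner false] matches each even
   vertex with its successor and [partner true] each odd one, except that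
   [partner true 0 = 0] and, for even [n], [partner true (n - 1) = n]. *)
Definition chain_mx n : 'M[W]_n := \matrix_(i, j)
  (if j == i :> nat then os_unit W else
   if j == partner false i :> nat then w_e R else
   if j == partner true i :> nat then w_f R else 0).

(* The blocks are the edges of the matching [partner b], unmatched vertices
   forming singletons. *)
Definition block (b : bool) (i : nat) : nat := if odd i == b then i else i.-1.

Lemma block_lt b n i : (i < n)%N -> (block b i < n)%N.
Proof. by rewrite /block; case: ifP => // _; case: i => //= i /ltnW. Qed.

Lemma block_eq b i j : (block b i == block b j) = (j == i) || (j == partner b i).
Proof.
rewrite /block /partner; have := odd_double_half i; have := odd_double_half j.
by case: b; case: (odd i); case: (odd j) => /= hi hj; apply/eqP/idP; lia.
Qed.

Lemma partner_neq i : partner false i != partner true i.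
Proof. by rewrite /partner; case: (odd i) => /=; lia. Qed.

(** In coordinates 1 and 3 an edge of the matching carries the entry [-1], so its ends get opposite
    signs; in coordinates 0 and 2 it carries [1]. Vertex 0 is unmatched in coordinate 3. *)
Definition block_sign (k i : nat) : C :=
  if (k == 1) && odd i || (k == 3) && ~~ odd i && (i != 0)%N then -1 else 1.

Lemma sum_two_deltas n x y (a b : C) : (x < n)%N ->
  \sum_(p < n) (p == x :> nat)%:R * a * ((p == y :> nat)%:R * b) = (x == y)%:R * (a * b).
Proof.
move=> xn; rewrite (bigD1 (Ordinal xn)) //= big1 ?addr0 ?eqxx ?mul1r; first ring.
move=> p px; rewrite (_ : (p == x :> nat) = false) ?mul0r //.
by apply: contraNF px => /eqP px; apply/eqP/val_inj.
Qed.

Lemma block_signE (k : nat) i j : j != i -> j == partner (1 < k)%N i ->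
  (k == 1)%N || (k == 3)%N -> block_sign k i * block_sign k j = -1.
Proof.
move=> + /eqP jE /orP[]/eqP kE; rewrite /block_sign jE kE /partner /=; case: i {jE} => [|i] /=.
- by rewrite mul1r.
- by case odi: (odd i); rewrite /= ?odi /= ?mulr1 ?mul1r.
- by [].
- by case odi: (odd i); rewrite /= ?odi /= ?mulr1 ?mul1r.
Qed.

Lemma block_sign_sqr k i : block_sign k i * block_sign k i = 1.
Proof. by rewrite /block_sign; case: ifP => _; rewrite ?mulrNN mulr1. Qed.

Lemma block_sign1 (k : nat) i : (k != 1)%N -> (k != 3)%N -> block_sign k i = 1.
Proof. by rewrite /block_sign => /negbTE -> /negbTE ->. Qed.

Lemma chain_mx_pos n : os_pos (chain_mx n).
Proof.
(* In each coordinate a block has rank one: it is [s s^T] for its vector [s] of signs. Row [p] of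
   [y] carries the block whose first vertex is [p]. *)
pose y : 'M[linf4 R]_n := \matrix_(p, i) [ffun k : 'I_4 =>
  (p == block (1 < k)%N i :> nat)%:R * block_sign k i].
exists y; apply/matrixP => i j; apply/ffunP => k; rewrite [in RHS]mxE sum_ffunE.
have sC : (block_sign k i)^*%R = block_sign k i.
  by rewrite /block_sign; case: ifP => _; rewrite ?rmorphN rmorph1.
transitivity (\sum_(p < n) (p == block (1 < k)%N i :> nat)%:R * block_sign k i *
      ((p == block (1 < k)%N j :> nat)%:R * block_sign k j)); last first.
  by apply: eq_bigr => p _; rewrite !mxE !ffunE rmorphM /= rmorph_nat sC.
rewrite (sum_two_deltas _ _ _ (block_lt _ (ltn_ord i))) block_eq.
rewrite [map_mx _ _ i j]mxE [chain_mx n i j]mxE -[LHS]/(coord k _).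
have [->|ji] := eqVneq (j : nat) i; first by rewrite coord_unit block_sign_sqr mulr1.
have [j0|j0] := eqVneq (j : nat) (partner false i).
  have j1 : (j != partner true i :> nat) by rewrite j0 partner_neq.
  rewrite coord_e; move: sC; move: k; apply: forall_I4 => _ /=.
  - by rewrite -j0 eqxx ?orbT !block_sign1 // !mulr1.
  - by rewrite -j0 eqxx ?orbT block_signE ?mulr1 ?mul1r // j0.
  - by rewrite (negbTE j1) mul0r.
  - by rewrite (negbTE j1) mul0r.
have [j1|j1] := eqVneq (j : nat) (partner true i).
  rewrite coord_f; move: sC; move: k; apply: forall_I4 => _ /=.
  - by rewrite (negbTE j0) mul0r.
  - by rewrite (negbTE j0) mul0r.
  - by rewrite -j1 eqxx ?orbT !block_sign1 // !mulr1.
  - by rewrite -j1 eqxx ?orbT block_signE ?mulr1 ?mul1r // j1.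
rewrite (_ : (j == partner (1 < k)%N i :> nat) = false) ?mul0r.
  by rewrite /coord linear0 ffunE.
by case: (1 < k)%N; apply/negbTE.
Qed.

(** For even [n] the matching [partner false] is perfect, so every row has its [w_e] term. Two rows
    lack a [w_f] term: at 0 the partner is 0 itself, taken by the diagonal, and at [n - 1] it falls
    outside. *)
Lemma sum_chain_mx (V : lmodType C) n (i : 'I_n) (g : nat -> V) : ~~ odd n ->
  \sum_(j < n) tens (chain_mx n i j) (g j) =
    tens (os_unit W) (g i) + tens (w_e R) (g (partner false i)) +
    (if (0 < i < n.-1)%N then tens (w_f R) (g (partner true i)) else 0).
Proof.
move=> nev; have hi := odd_double_half i; have hn := odd_double_half n; have i_n := ltn_ord i.
have p0 : (partner false i < n)%N.
  by move: nev hi hn; rewrite /partner; case: (odd i); case: (odd n) => //= _ *; lia.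
have p1 : (partner true i < n)%N = (i < n.-1)%N.
  by move: nev hi hn; rewrite /partner; case: (odd i); case: (odd n) => //= _ *; apply/idP/idP; lia.
transitivity (\sum_(j < n) ((if j == i :> nat then tens (os_unit W) (g j) else 0) +
    (if j == partner false i :> nat then tens (w_e R) (g j) else 0) +
    (if j == partner true i :> nat then
       if (0 < i)%N then tens (w_f R) (g j) else 0 else 0))).
  apply: eq_bigr => j _; rewrite mxE.
  have [ji|ji] := eqVneq (j : nat) i.
    have -> : (j == partner false i :> nat) = false.
      by rewrite ji /partner; apply/eqP; case: (odd i) hi => /=; lia.
    case: posnP => [i0|ip]; first by case: ifP; rewrite !addr0.
    have -> : (j == partner true i :> nat) = false.
      by rewrite ji /partner; apply/eqP; case: (odd i) hi => /=; lia.
    by rewrite !addr0.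
  have [j0|j0] := eqVneq (j : nat) (partner false i).
    have -> : (j == partner true i :> nat) = false.
      by apply/negbTE; rewrite j0 partner_neq.
    by rewrite addr0 add0r.
  rewrite !add0r; have [j1|j1] := eqVneq (j : nat) (partner true i).
    rewrite lt0n ifT //; apply: contraNneq ji => i0.
    by rewrite j1 i0.
  by rewrite linear0l.
have one (U : nmodType) x (F : nat -> U) :
    \sum_(j < n) (if j == x :> nat then F j else 0) = if (x < n)%N then F x else 0.
  by rewrite -big_mkcond big_ord1_eq.
rewrite !big_split /= (one _ _ (fun j => tens _ (g j))) (one _ _ (fun j => tens _ (g j))).
rewrite (one _ _ (fun j => if (0 < i)%N then tens (w_f R) (g j) else 0)) ltn_ord p0 p1.
by case: (0 < i)%N; case: ifP.
Qed.
(** Of the [2 (N + 1)] vertices only [2 N] are interior: this is the origin of the ratio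
    [N / (N + 1)]. *)
Lemma sum_chain_const (V : lmodType C) N (a : C) (c u v : V) :
  \sum_(i < N.+1.*2) (tens (os_unit W) (a *: c) + tens (w_e R) (a *: u) +
    (if (0 < i < N.+1.*2.-1)%N then tens (w_f R) (a *: v) else 0)) =
  tens (os_unit W) ((a * N.+1.*2%:R) *: c) + tens (w_e R) ((a * N.+1.*2%:R) *: u) +
    tens (w_f R) ((a * N.*2%:R) *: v).
Proof.
rewrite !big_split /= !sumr_const !card_ord.
have -> : \sum_(i < N.+1.*2) (if (0 < i < N.+1.*2.-1)%N then tens (w_f R) (a *: v) else 0) =
    tens (w_f R) (a *: v) *+ N.*2.
  rewrite doubleS big_ord_recl big_ord_recr /= add0r /bump leq0n add1n ltnn addr0.
  by rewrite (eq_bigr (fun=> tens (w_f R) (a *: v)));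
    [rewrite sumr_const card_ord | move=> i _; rewrite /= add1n ltnS ltn_ord].
have mulE n (w : V) : (a *: w) *+ n = (a * n%:R) *: w by rewrite -scaler_nat scalerA mulrC.
by rewrite -!linearMnr !mulE.
Qed.
End ChainMatrix.

(** * The minimal cone lies in the maximal cone *)

Section Nuclear.
Variables (R : realType) (A : cstarAlgType R).
Local Notation C := R[i].
Local Notation W := (W22 R).
Local Notation WA := (tensor W (cstar_opsys A)).
Local Notation cst := (@cst R A).

Lemma max_pre_chain r (c g u v : 'M[A]_r) N :
  c *m g = 1%:M -> g *m c = 1%:M -> adjmx g = g -> adjmx u = u -> adjmx v = v ->
  sos c -> sos (c - u *m g *m u) -> sos (c - v *m g *m v) ->
  @max_pre R W (cstar_opsys A) r (\matrix_(k, l)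
    (tens (os_unit W) (((2 : C)^-1 *: c k l : A) : cstar_opsys A) +
     tens (w_e R) ((2 : C)^-1 *: u k l) +
     tens (w_f R) (((2 : C)^-1 * (N%:R / N.+1%:R)) *: v k l))).
Proof.
move=> cg gc sg su sv sc hu hv; pose n := N.+1.*2.
have [M [b [b1 b2]]] := isometric_chain n.-1 cg gc sg su sv sc hu hv.
(* All [n] rows contribute [c] and [u], so the weight [kap] gives them the coefficient [1 / 2]; its
   square root is put on the columns [b i]. *)
pose kap : R := (2 * n%:R)^-1; have kap0 : 0 <= kap by rewrite invr_ge0 mulr_ge0.
have := max_pre_gram (fun i : 'I_n => cst (Num.sqrt kap) *: b i) (chain_mx_pos R n).
congr max_pre; apply/matrixP => k l; rewrite ![(\matrix_(_, _) _) k l]mxE.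
have nev : ~~ odd n by rewrite /n odd_double.
(* Each edge is also traversed backwards, with the same value because [u] and [v] are
   self-adjoint. *)
have b3 j : (j < n.-1)%N -> adjmx (b j.+1) *m b j = if odd j then v else u.
  move=> jn; rewrite -[b j in LHS]adjmxK -adjmxM b2 //.
  by case: (odd j).
have u1 j : (j < n)%N -> adjmx (b j) *m b (partner false j) = u.
  rewrite /partner; case: j => [|j] jn /=; first by rewrite b2.
  case oj: (odd j) => /=; last by rewrite b3 ?oj.
  rewrite b2 /= ?oj // ltn_neqAle; move: jn; rewrite -[n]prednK // ltnS => ->; rewrite andbT.
  by apply: contraL oj => /eqP [->]; rewrite /n /= odd_double.
have v1 j : (0 < j < n.-1)%N -> adjmx (b j) *m b (partner true j) = v.
  rewrite /partner; case: j => [//|j] /= jn; case oj: (odd j) => /=.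
    by rewrite b3 ?oj // ltnW.
  by rewrite b2 /= ?oj.
transitivity (\sum_(i < n) (tens (os_unit W) ((kap%:C *: c k l : A) : cstar_opsys A) +
   tens (w_e R) (kap%:C *: u k l) +
   (if (0 < i < n.-1)%N then tens (w_f R) (kap%:C *: v k l) else 0))).
  apply: eq_bigr => i _.
  pose h j : cstar_opsys A := (adjmx (cst (Num.sqrt kap) *: b i) *m (cst (Num.sqrt kap) *: b j)) k l.
  have hE j : h j = kap%:C *: (adjmx (b i) *m b j) k l.
    rewrite /h adj_scale_cst mulmx_cst -scalemxAl scalerA cstM -expr2 sqr_sqrtr //.
    by rewrite mxE cst_mul.
  rewrite (sum_chain_mx i h nev) !hE b1 ?u1 //; last by rewrite -ltnS prednK.
  by case: ifP => // /v1 ->.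
rewrite (sum_chain_const _ _ (c k l : cstar_opsys A)) -/n.
have kC : kap%:C = (2 * (2 * N.+1%:R))^-1.
  by rewrite fmorphV rmorphM /= !rmorph_nat /n -mul2n natrM.
have N0 : N.+1%:R != 0 :> C by rewrite pnatr_eq0.
have -> : kap%:C * n%:R = 2^-1.
  by rewrite kC /n -mul2n natrM invfM -mulrA mulVf ?mulr1 // mulf_neq0 ?pnatr_eq0.
suff -> : kap%:C * N.*2%:R = 2^-1 * (N%:R / N.+1%:R) by [].
rewrite kC -mul2n natrM !invfM -mulrA mulrACA mulVf ?pnatr_eq0 // mul1r.
by rewrite [_^-1 * N%:R]mulrC.
Qed.

Local Notation slicek k := (slice (coordl R k) : {linear WA -> A}).

Lemma min_pos_max_pos r (x : 'M[WA]_r) : min_pos x -> max_pos x.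
Proof.
move=> hx e e0; pose a k := map_mx (slicek k) x.
have as_ k := sos_of_ucp_tests (min_pos_slice k hx).
have sa k : adjmx (a k) = a k := (as_ k).1.
have pa k d (d0 : 0 < d) : sos (a k + (cst d)%:M) := (as_ k).2 d d0.
have a_rel : a 0 + a 1 = a 2 + a 3.
  by apply/matrixP => i j; have [+ _] := w22_tensor (x i j); rewrite !mxE.
pose w := a 2 - a 3; have sw : adjmx w = w by rewrite raddfB /= !sa.
have [t1 [t10 ht1]] := sos_order_unit w; have [t2 [t20 ht2]] := sos_order_unit (- w).
(* [N] is large enough that the correction [eta w] below stays within [e / 2] in both directions. *)
have [N N0 hN] : exists2 N, (0 < N)%N & t1 + t2 <= e * N%:R.
  exists (Num.Def.archi_bound ((t1 + t2) / e)).+1 => //.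
  rewrite mulrC -ler_pdivrMr // ltW // (lt_trans (archi_boundP _)) ?ltr_nat //.
  by rewrite divr_ge0 ?addr_ge0 // ltW.
have Np : 0 < N%:R :> R by rewrite ltr0n.
(* Chosen so that [1 + 2 eta = (N + 1) / N] is the inverse of the boundary factor. *)
pose eta : R := (2 * N%:R)^-1; have eta0 : 0 <= eta by rewrite invr_ge0 mulr_ge0.
have slack (y : 'M[A]_r) t : 0 <= t -> t <= e * N%:R -> adjmx y = y ->
    sos ((cst t)%:M - (y + adjmx y)) -> sos ((cst (e / 2))%:M - cst eta *: y).
  move=> t0 tN sy hy.
  have -> : (cst (e / 2))%:M - cst eta *: y =
      cst (eta / 2) *: ((cst t)%:M - (y + adjmx y)) + (cst (e / 2 - eta / 2 * t))%:M.
    rewrite sy scalerBr scale_scalar_mx cstM scalerDr -scalerDl cstD -splitr.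
    by rewrite addrAC -raddfD /= cstD subrKC.
  apply: sosD; first by apply: sosZ => //; rewrite divr_ge0.
  apply: sos_cst; have : eta * t <= e / 2.
    by rewrite /eta mulrC ler_pdivrMr ?mulr_gt0 // mulrA divfK ?pnatr_eq0.
  lra.
(* The endpoints of the path miss one [v] edge, which costs the factor [N / (N + 1)]
   in [max_pre_chain]; [b2] and [b3] compensate for it within the slack [e]. *)
pose b2 := a 2 + (cst e)%:M + cst eta *: w; pose b3 := a 3 + (cst e)%:M - cst eta *: w.
have e2 : 0 < e / 2 by rewrite divr_gt0.
have ee : (cst e)%:M = (cst (e / 2))%:M + (cst (e / 2))%:M :> 'M[A]_r.
  by rewrite -raddfD /= cstD -splitr.
have sb2 : sos b2.
  rewrite /b2 ee (addrA (a 2)) -(addrA (a 2 + _)); apply: sosD; first exact: pa.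
  rewrite -[cst eta *: w]opprK -scalerN; apply: (slack _ t2) => //; last by rewrite raddfN /= sw.
  by apply: le_trans hN; rewrite lerDr.
have sb3 : sos b3.
  rewrite /b3 ee (addrA (a 3)) -(addrA (a 3 + _)); apply: sosD; first exact: pa.
  by apply: (slack _ t1) => //; apply: le_trans hN; rewrite lerDl.
pose b0 := a 0 + (cst e)%:M; pose b1 := a 1 + (cst e)%:M.
have sb0 : sos b0 by exact: pa. have sb1 : sos b1 by exact: pa.
pose c := b0 + b1; have cE : c = b2 + b3.
  by rewrite /c /b0 /b1 /b2 /b3 addrACA a_rel [RHS]addrACA subrr addr0 [RHS]addrACA.
pose u := b0 - b1; pose v := b2 - b3.
(* Half of each [e] is spent on making [a 0] and [a 1] sums of squares; the other halves add up to
   the scalar that makes [c] invertible. *)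
have [g [cg gc sg]] : exists g, [/\ c *m g = 1%:M, g *m c = 1%:M & adjmx g = g].
  have -> : c = (a 0 + (cst (e / 2))%:M) + (a 1 + (cst (e / 2))%:M) + (cst e)%:M.
    by rewrite /c /b0 /b1 addrACA [in RHS]addrACA -ee addrA.
  by apply: sos_add_cst_inv => //; apply: sosD; exact: pa.
have hv : sos (c - v *m g *m v).
  by move: cg gc; rewrite cE => cg gc; apply: sos_parallel.
have hu : sos (c - u *m g *m u) by exact: sos_parallel.
have adj_u : adjmx u = u by rewrite /u raddfB /= !sos_adj.
have adj_v : adjmx v = v by rewrite /v raddfB /= !sos_adj.
have := max_pre_chain N cg gc sg adj_u adj_v (sosD sb0 sb1) hu hv.
congr max_pre; apply/matrixP => k l; rewrite [LHS]mxE.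
set y := (x + _) k l.
(* Every coordinate of the unit is 1, so perturbing [x] by the order unit shifts all four slices by
   the same [e]. *)
have sy i : slicek i y = (a i + (cst e)%:M) k l.
  rewrite /y [(x + _) k l]mxE [(_ *: _)%:M k l]mxE linearD /= [RHS]mxE [a i k l]mxE.
  congr (_ + _); rewrite [RHS]mxE; case: (k == l); rewrite ?mulr0n ?linear0 // !mulr1n.
  rewrite linearZ sliceE; congr (_ *: _).
  exact: etrans (congr1 (fun z => z *: (1 : A)) (coord_unit R i)) (scale1r _).
have [_ ->] := w22_tensor y; rewrite !sy.
have vE : v = cst (1 + 2 * eta) *: w.
  have wE : a 2 + (cst e)%:M - (a 3 + (cst e)%:M) = w by rewrite opprD addrACA subrr addr0.
  rewrite /v /b2 /b3 opprB [LHS]addrA -[X in X - _]addrA [LHS]addrAC wE -scalerDl cstD.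
  by rewrite mulr_natl mulr2n [in RHS]rmorphD rmorph1 scalerDl scale1r.
have coef : 2^-1 * (N%:R / N.+1%:R) * (1 + 2 * eta)%:C = 2^-1 :> C.
  have -> : 1 + 2 * eta = N.+1%:R / N%:R.
    by rewrite /eta invfM mulrA divff ?pnatr_eq0 // mul1r -natr1 mulrDl divff ?gt_eqF // mul1r.
  rewrite rmorphM fmorphV /= !rmorph_nat -!mulrA mulKf ?pnatr_eq0 //.
  by rewrite divff ?mulr1 // pnatr_eq0 -lt0n.
have vkl : (2^-1 * (N%:R / N.+1%:R)) *: v k l = 2^-1 *: w k l :> A.
  by rewrite vE mxE cst_mul scalerA coef.
have ckl : c k l = (a 0 + (cst e)%:M) k l + (a 1 + (cst e)%:M) k l by rewrite mxE.
have ukl : u k l = (a 0 + (cst e)%:M) k l - (a 1 + (cst e)%:M) k l by rewrite !mxE.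
have wkl : w k l = (a 2 + (cst e)%:M) k l - (a 3 + (cst e)%:M) k l.
  by rewrite !mxE opprD addrACA subrr addr0.
by rewrite vkl ckl ukl wkl.
Qed.
End Nuclear.

Theorem theorem0p4 (R : realType) : cstar_nuclear (W22 R).
Proof.
move=> A; exists idfun; split => // r x hx.
  by rewrite map_mx_id //; exact: min_pos_max_pos.
by rewrite map_mx_id //; exact: max_pos_min_pos.
Qed.
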